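(* Let $G$ be (the $k$-points of) a connected reductive group, $(\pi,V)$ a finitely generated admissible representation of $G$, $e\ge e_0(V)$ an integer, and $f\in C_c^\infty(G)$. Fix direct sum decompositions $C_q=B_q\oplus H_q'\oplus B_{q-1}'$ ($0\le q\le d$) as in the context, and let $\overline Q_q^r$ be the associated modified truncation operators. Then there exists a radius $r_0(f)$ such that for all $r\ge r_0(f)$ $$\sum_{q=0}^{d}(-1)^q\,\mathrm{trace}\bigl(T_f\overline Q_q^r; C_q\bigr)=\mathrm{trace}\bigl(\pi(f);V\bigr).$$
   Context: Setting. $k$ is a finite extension of some $\mathbb{Q}_p$, $\mathbf G$ is a connected reductive group over $k$, $G=\mathbf G(k)$ with a fixed Haar measure. $X$ is the semisimple Bruhat–Tits building of $G$ (the Bruhat–Tits building of the derived group): a locally finite polysimplicial complex of dimension $d$ = semisimple $k$-rank of $G$, with a polysimplicial isometric $G$-action, metric $d(\cdot,\cdot)$ and unique geodesics; $X_{(q)}$ is the set of oriented $q$-dimensional facets. $C_c^\infty(G)$ is the space of locally constant compactly supported complex functions, and $\pi(f)v=\int_G f(g)\pi(g)v\,dg$. Schneider–Stuhler groups. For each facet $F$ and integer $e\ge0$, $U_F^{(e)}$ is the subgroup of $G$ attached to $F$ and $e$ by Schneider–Stuhler (Representation theory and sheaves on the Bruhat–Tits building, Ch. I). They satisfy: $U_F^{(e)}$ is open, compact, and normal in the stabilizer $P_F^\dagger$ of $F$, and fixes $F$ pointwise; $gU_F^{(e)}g^{-1}=U_{gF}^{(e)}$; for fixed $F$ they form a fundamental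 system of neighborhoods of $1$ as $e$ varies; $U_{F'}^{(e)}\subset U_F^{(e)}$ if $F'\subset\overline F$. Chains. $C_q$ (depending on $e$) is the space of finitely supported maps $\omega:X_{(q)}\to V$ with $\omega((F,c))\in V^{U_F^{(e)}}$ and, if $q\ge1$, $\omega((F,-c))=-\omega((F,c))$. $G$ acts smoothly on $C_q$ by $(T_g\omega)((F,c))=\pi(g)\,\omega((g^{-1}F,g^{-1}c))$; $T_f\omega=\int_G f(g)T_g\omega\,dg$. The boundary $\partial:C_{q+1}\to C_q$ is $(\partial\omega)((F',c'))=\sum\omega((F,c))$ over oriented $(q+1)$-facets $(F,c)$ with $F'\subset\overline F$ and $c$ inducing $c'$ on $F'$; $\epsilon:C_0\to V$ is $\epsilon(\omega)=\sum_F\omega(F)$. $e_0(V)$ is an integer such that for all $e\ge e_0(V)$ the complex $0\to C_d\to\cdots\to C_0\xrightarrow{\epsilon}V\to0$ is exact (such an integer exists by Schneider–Stuhler). Truncation. Fix a point $o\in X$. For real $r\ge0$, $X^r$ is obtained from the closed ball $B(o,r)$ by alternately taking the (geodesic) convex hull and the smallest subcomplex containing the set, until this stabilizes (it does, after finitely many steps); $X^r$ is a convex finite subcomplex containing $B(o,r)$. The truncation operator $Q_q^r$ on $C_q$ restricts a chain to the facets contained in $X^r$ (extended by zero); i.e. it is the projection of $C_q$ onto the chains supported in $X^r$ along the chains supported on facets not contained in $X^r$. Decompositions and modified truncation. Let $Z_q=\ker(\partial:C_q\to C_{q-1})$ (with $Z_0=C_0$) and $B_q=\partial(C_{q+1})$.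 Fix vector space complements: $B_{q-1}'$ of $Z_q$ in $C_q$ (so $\partial:B_{q-1}'\to B_{q-1}$ is an isomorphism; $B_{-1}'=0$) and $H_q'$ of $B_q$ in $Z_q$. This gives $C_q=B_q\oplus H_q'\oplus B_{q-1}'$; let $p_B,p_{H'},p_{B'}$ be the corresponding projections. Let $\widetilde Q_{q-1}^r$ be the operator on $B_{q-1}'$ which corresponds, via $\partial:B_{q-1}'\cong B_{q-1}$, to the operator $b\mapsto p_B Q_{q-1}^r b$ on $B_{q-1}$. The modified truncation operator $\overline Q_q^r$ on $C_q$ is the linear operator with $\overline Q_q^r b=p_BQ_q^rb$ for $b\in B_q$; $\overline Q_q^r h=p_BQ_q^rh+p_{H'}Q_q^rh$ for $h\in H_q'$; $\overline Q_q^r b'=p_BQ_q^rb'+p_{H'}Q_q^rb'+\widetilde Q_{q-1}^rb'$ for $b'\in B_{q-1}'$. These operators have finite rank, so the traces make sense. *)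

(* Defs.v *)
From HB Require Import structures.
From mathcomp Require Import all_boot all_order all_algebra all_field.
From mathcomp Require Import perm.
From mathcomp Require Import all_classical all_reals all_analysis.
From mathcomp Require Import complex.
From mathcomp Require mpoly.

Set Implicit Arguments.
Unset Strict Implicit.
Unset Printing Implicit Defensive.

Import Order.TTheory GRing.Theory Num.Theory.
Import numFieldNormedType.Exports.

Local Open Scope classical_set_scope.
Local Open Scope ring_scope.
Local Open Scope complex_scope.

(* (F, absv) is a completion of the rationals for the p-adic absolute value. *)
Record is_Qp (R : realType) (p : nat) (F : fieldType) (absv : F -> R) : Prop := {
  Qp_prime : prime p;
  Qp_abs_ge0 : forall x, 0 <= absv x;
  Qp_abs_eq0 : forall x, absv x = 0 <-> x = 0;
  Qp_absM : forall x y, absv (x * y) = absv x * absv y;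
  Qp_ultrametric : forall x y, absv (x + y) <= Num.max (absv x) (absv y);
  Qp_abs_p : absv p%:R = p%:R^-1;
  Qp_dense : forall x eps, 0 < eps -> exists q : rat, absv (x - ratr q) < eps;
  Qp_complete : forall u : nat -> F,
    (forall eps, 0 < eps -> exists N, forall i j,
      (N <= i)%N -> (N <= j)%N -> absv (u i - u j) < eps) ->
    exists l, forall eps, 0 < eps -> exists N, forall i,
      (N <= i)%N -> absv (u i - l) < eps }.

(* Sup norm in a basis: it induces the canonical topology of a finite        *)
(* extension of Q_p (all norms on a finite-dimensional space are equivalent). *)
Definition coord_norm (R : realType) (F : fieldType) (absv : F -> R)
    (k : fieldExtType F) (x : k) : R :=
  \big[Num.max/0]_(i < \dim {:k}) absv (coord (vbasis {:k}) i x).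

Definition mx_subgroup (K : fieldType) (n : nat) (H : set 'M[K]_n) : Prop :=
  [/\ H `<=` [set A | A \in unitmx], H 1%:M,
      forall A B, H A -> H B -> H (A *m B)
    & forall A, H A -> H (invmx A)].

(* Zero locus in GL_n(K) of polynomials in the matrix entries whose          *)
(* coefficients are transported to K along f.                                *)
Definition zero_locus (k K : fieldType) (f : k -> K) (n : nat)
    (S : set (mpoly.mpoly (n * n) k)) : set 'M[K]_n :=
  [set A | A \in unitmx /\
    forall P, S P -> mpoly.mmap f (fun i => mxvec A 0 i) P = 0].

Definition zariski_closed (K : fieldType) (n : nat) (Z : set 'M[K]_n) : Prop :=
  exists S, Z = zero_locus id S.

Definition zariski_connected (K : fieldType) (n : nat) (Z : set 'M[K]_n) : Prop :=
  forall A B, zariski_closed A -> zariski_closed B ->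
    Z = A `|` B -> A `&` B = set0 -> A = set0 \/ B = set0.

(* K is an algebraic closure of k. As k has characteristic 0, an affine      *)
(* algebraic k-group is smooth and is determined by its group of K-points, a *)
(* subgroup of some GL_n(K) cut out by polynomials over k.                   *)
Record algebraicGroup (k K : fieldType) (iota : {rmorphism k -> K}) (n : nat) := {
  geom_points :> set 'M[K]_n;
  geom_points_subgroup : mx_subgroup geom_points;
  geom_points_defined : exists S, geom_points = zero_locus iota S }.

Section AlgebraicGroups.
Variables (k K : fieldType) (iota : {rmorphism k -> K}) (n : nat).
Implicit Types (GG : algebraicGroup iota n) (S : set 'M[K]_n).

(* The unipotent radical is trivial. *)
Definition is_reductive GG : Prop :=
  forall U : set 'M[K]_n, U `<=` GG -> mx_subgroup U -> zariski_closed U ->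
    zariski_connected U ->
    (forall g u, geom_points GG g -> U u -> U (g *m u *m invmx g)) ->
    (forall u, U u -> (u - 1%:M) ^+ n = 0) ->
    U = [set 1%:M].

Definition derived_group GG : set 'M[K]_n :=
  [set A | forall H : set 'M[K]_n, mx_subgroup H ->
    (forall x y, geom_points GG x -> geom_points GG y -> H (invmx x *m invmx y *m x *m y)) -> H A].

(* After conjugation by an element of GL_n(k), a split k-torus of dimension d *)
(* in GL_n is the image of t |-> diag(prod_j t_j ^ m_ij)_i for an n x d       *)
(* integer matrix m of rank d.                                                *)
Definition is_split_torus (d : nat) S : Prop :=
  exists (P : 'M[k]_n) (m : 'M[int]_(n, d)),
    [/\ P \in unitmx,
        \rank (map_mx intr m : 'M[rat]_(n, d)) = d
      & S = [set map_mx iota (invmx P)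
                 *m diag_mx (\row_(i < n) \prod_(j < d) t j ^ m i j)
                 *m map_mx iota P
            | t in [set t : 'I_d -> K | forall j, t j != 0]]].

Definition is_semisimple_rank GG (d : nat) : Prop :=
  (exists S, S `<=` derived_group GG /\ is_split_torus d S) /\
  (forall d' S, S `<=` derived_group GG -> is_split_torus d' S -> (d' <= d)%N).

End AlgebraicGroups.

#[short(type="ptopGroupType")]
HB.structure Definition PTopGroup := {G of Group G & PointedTopological G}.

(* The unused absolute value selects the topology put on this type below. *)
Definition kpoints (R : realType) (F : fieldType) (absv : F -> R)
    (k : fieldExtType F) (K : fieldType) (iota : {rmorphism k -> K}) (n : nat)
    (GG : algebraicGroup iota n) : Type :=
  {A : 'M[k]_n | `[< geom_points GG (map_mx iota A) >]}.

Section KPoints.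
Variables (R : realType) (F : fieldType) (absv : F -> R) (k : fieldExtType F).
Variables (K : fieldType) (iota : {rmorphism k -> K}) (n : nat).
Variable GG : algebraicGroup iota n.
Notation G := (kpoints absv GG).

HB.instance Definition _ := Choice.on G.

Lemma kpointsP (x : G) : geom_points GG (map_mx iota (val x)).
Proof. exact/asboolP/(valP x). Qed.

Lemma kpoints_unit (x : G) : val x \in unitmx.
Proof.
have [sub _ _ _] := geom_points_subgroup GG.
by have /sub /= := kpointsP x; rewrite map_unitmx.
Qed.

Lemma kpoints1_subproof : `[< geom_points GG (map_mx iota 1%:M) >].
Proof. by apply/asboolP; rewrite map_mx1; have [] := geom_points_subgroup GG. Qed.

Lemma kpointsM_subproof (x y : G) :
  `[< geom_points GG (map_mx iota (val x *m val y)) >].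
Proof.
apply/asboolP; rewrite map_mxM; have [_ _ mulG _] := geom_points_subgroup GG.
exact: mulG (kpointsP x) (kpointsP y).
Qed.

Lemma kpointsV_subproof (x : G) : `[< geom_points GG (map_mx iota (invmx (val x))) >].
Proof.
apply/asboolP; rewrite map_invmx; have [_ _ _ invG] := geom_points_subgroup GG.
exact: invG (kpointsP x).
Qed.

Let is_kpoint (A : 'M[k]_n) : bool := `[< geom_points GG (map_mx iota A) >].
Definition kpoints1 : G := exist is_kpoint _ kpoints1_subproof.
Definition kpointsM (x y : G) : G := exist is_kpoint _ (kpointsM_subproof x y).
Definition kpointsV (x : G) : G := exist is_kpoint _ (kpointsV_subproof x).

Fact kpointsMA : associative kpointsM.
Proof. by move=> x y z; apply/val_inj; rewrite /= mulmxA. Qed.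
Fact kpoints1M : left_id kpoints1 kpointsM.
Proof. by move=> x; apply/val_inj; rewrite /= mul1mx. Qed.
Fact kpointsM1 : right_id kpoints1 kpointsM.
Proof. by move=> x; apply/val_inj; rewrite /= mulmx1. Qed.
Fact kpointsVM : left_inverse kpoints1 kpointsV kpointsM.
Proof. by move=> x; apply/val_inj; rewrite /= mulVmx// kpoints_unit. Qed.
Fact kpointsMV : right_inverse kpoints1 kpointsV kpointsM.
Proof. by move=> x; apply/val_inj; rewrite /= mulmxV// kpoints_unit. Qed.

HB.instance Definition _ := isGroup.Build G
  kpointsMA kpoints1M kpointsM1 kpointsVM kpointsMV.
HB.instance Definition _ := isPointed.Build G kpoints1.

(* Subspace topology from the matrix space over k. *)
Definition kpoints_open : set (set G) :=
  [set A | forall x : G, A x -> exists2 eps : R, 0 < eps & forall y : G,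
    (forall i j, coord_norm absv (val y i j - val x i j) < eps) -> A y].

Fact kpoints_openT : kpoints_open setT.
Proof. by move=> x _; exists 1. Qed.

Fact kpoints_openI : setI_closed kpoints_open.
Proof.
move=> A B oA oB x [Ax Bx].
have [a a0 hA] := oA x Ax; have [b b0 hB] := oB x Bx.
exists (Num.min a b) => [|y hy]; first by rewrite lt_min a0 b0.
by split; [apply: hA | apply: hB] => i j; have := hy i j;
  rewrite lt_min => /andP[].
Qed.

Fact kpoints_open_bigcup (I : Type) (f : I -> set G) :
  (forall i, kpoints_open (f i)) -> kpoints_open (\bigcup_i f i).
Proof.
move=> of_ x [i _ fx]; have [eps e0 h] := of_ i x fx.
by exists eps => // y /h fy; exists i.
Qed.

HB.instance Definition _ := @isOpenTopological.Build G kpoints_open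
  kpoints_openT kpoints_openI kpoints_open_bigcup.

End KPoints.

Definition is_subgroup (G : groupType) (H : set G) : Prop :=
  [/\ H 1%g, forall x y, H x -> H y -> H (x * y)%g & forall x, H x -> H x^-1%g].

Notation borel G := (g_sigma_algebraType (@open G)).

Record is_haar (R : realType) (G : ptopGroupType)
    (mu : {measure set (borel G) -> \bar R}) : Prop := {
  haar_left_invariant : forall (g : G) (A : set (borel G)), measurable A ->
    mu [set (g * x)%g | x in A] = mu A;
  haar_compact : forall A : set G, compact A -> measurable (A : set (borel G)) ->
    (mu A < +oo)%E;
  haar_open : forall A : set G, open A -> A !=set0 -> (0 < mu A)%E }.

(* Integral of a locally constant compactly supported map: it takes finitely *)
(* many nonzero values, each on a compact open set.                          *)
Definition integral_lc (R : realType) (G : ptopGroupType)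
    (mu : {measure set (borel G) -> \bar R}) (M : lmodType R[i])
    (phi : G -> M) : M :=
  \sum_(w \in [set w : M | w <> 0]) (fine (mu (phi @^-1` [set w])))%:C *: w.

Definition is_test_function (R : realType) (G : ptopGroupType)
    (f : G -> R[i]) : Prop :=
  (forall g : G, \forall h \near g, f h = f g) /\
  (exists2 A : set G, compact A & forall g, ~ A g -> f g = 0).

Record representation (R : realType) (G : ptopGroupType) (V : lmodType R[i]) := {
  rep_fun :> G -> {linear V -> V};
  rep1 : forall v, rep_fun 1%g v = v;
  repM : forall g h v, rep_fun (g * h)%g v = rep_fun g (rep_fun h v) }.

Section Representations.
Variables (R : realType) (G : ptopGroupType) (V : lmodType R[i]).
Variable pi : representation G V.

Definition fixed_vectors (H : set G) : set V :=
  [set v | forall g, H g -> pi g v = v].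

Definition is_smooth : Prop := forall v : V, open [set g : G | pi g v = v].

Definition is_admissible : Prop :=
  is_smooth /\
  forall H : set G, is_subgroup H -> open H -> compact H ->
    exists (n : nat) (b : 'I_n -> V), forall v, fixed_vectors H v ->
      exists c : 'I_n -> R[i], v = \sum_i c i *: b i.

Definition is_finitely_generated : Prop :=
  exists (n : nat) (b : 'I_n -> V), forall v, exists (m : nat)
    (c : 'I_m -> R[i]) (g : 'I_m -> G) (i : 'I_m -> 'I_n),
    v = \sum_j c j *: pi (g j) (b (i j)).

Definition rep_of_fun (mu : {measure set (borel G) -> \bar R})
    (f : G -> R[i]) (v : V) : V :=
  integral_lc mu (fun g => f g *: pi g v).

End Representations.

Section LinearAlgebra.
Variables (C : fieldType) (M : lmodType C).
Implicit Types (W Z : set M) (T : M -> M).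

Definition is_subspace W : Prop :=
  W 0 /\ forall a x y, W x -> W y -> W (a *: x + y).

Definition is_complement W' Z W : Prop :=
  [/\ is_subspace W', W' `<=` W, Z `&` W' = [set 0]
    & forall w, W w -> exists z w', [/\ Z z, W' w' & w = z + w']].

(* t is the trace of T on W: the image of T is contained in the span of      *)
(* finitely many independent vectors of W, and t is the trace of T on it.    *)
Definition is_trace W T (t : C) : Prop :=
  exists (n : nat) (b : 'I_n -> M) (a : 'M[C]_n),
    [/\ forall i, W (b i),
        forall c : 'I_n -> C, \sum_i c i *: b i = 0 -> forall i, c i = 0,
        forall w, W w -> exists c : 'I_n -> C, T w = \sum_i c i *: b i,
        forall i, T (b i) = \sum_j a i j *: b j
      & t = \tr a].

Definition trace W T : C := xget 0 (is_trace W T).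

(* Components along W1 + W2 + W3, assumed to be a direct sum. *)
Definition components W1 W2 W3 (w : M) : M * M * M :=
  xget (0, 0, 0) [set x | [/\ W1 x.1.1, W2 x.1.2, W3 x.2
                            & w = x.1.1 + x.1.2 + x.2]].

End LinearAlgebra.

Section Polysimplices.
Variable R : realType.

(* Closed polysimplex in barycentric coordinates: the product over j of the  *)
(* simplices with vertex sets [set i | beta i = j].                          *)
Definition polysimplex (N m : nat) (beta : 'I_N -> 'I_m) : set ('I_N -> R) :=
  [set l | (forall i, 0 <= l i) /\ forall j, \sum_(i | beta i == j) l i = 1].

Definition open_face (N m : nat) (beta : 'I_N -> 'I_m) (J : {set 'I_N}) :
    set ('I_N -> R) :=
  [set l | polysimplex beta l /\ forall i, (l i == 0) = (i \in J)].

Definition realize (N q : nat) (v : 'I_N -> 'rV[R]_q) (l : 'I_N -> R) : 'rV[R]_q :=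
  \sum_i l i *: v i.

Definition euclidean_dist (q : nat) (x y : 'rV[R]_q) : R :=
  Num.sqrt (\sum_i (x 0 i - y 0 i) ^+ 2).

Variables (X : metricType R) (facet : set (set X)).

(* chi maps the nondegenerate closed polysimplex P of R^q isometrically onto *)
(* the closure of A, its interior onto A and its open faces onto facets. As  *)
(* `realize v` is injective on a product of m simplices with q + m vertices  *)
(* in total, P has dimension q.                                              *)
Definition is_chart (A : set X) (q : nat) (P : set 'rV[R]_q)
    (chi : 'rV[R]_q -> X) : Prop :=
  exists (m : nat) (beta : 'I_(q + m) -> 'I_m) (v : 'I_(q + m) -> 'rV[R]_q),
    [/\ forall l l', polysimplex beta l -> polysimplex beta l' ->
          realize v l = realize v l' -> l = l',
        P = realize v @` polysimplex beta,
        forall x y, P x -> P y -> mdist (chi x) (chi y) = euclidean_dist x y,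
        A = chi @` (realize v @` open_face beta finset.set0)
      & forall J, open_face beta J !=set0 ->
          facet (chi @` (realize v @` open_face beta J))].

(* Facets are the open ones; they partition X. *)
Record is_polysimplicial_complex (d : nat) : Prop := {
  facet_nonempty : forall A, facet A -> A !=set0;
  facet_cover : forall x, exists2 A, facet A & A x;
  facet_disjoint : forall A B, facet A -> facet B -> A `&` B !=set0 -> A = B;
  facet_chart : forall A, facet A -> exists q P chi, @is_chart A q P chi;
  facet_locally_finite : forall x : X, exists2 N, nbhs x N &
    finite_set [set A | facet A /\ A `&` N !=set0];
  complex_dim_le : forall A q P chi,
    facet A -> @is_chart A q P chi -> (q <= d)%N;
  complex_dim : exists A P chi, facet A /\ @is_chart A d P chi }.

Definition is_subcomplex (Y : set X) : Prop :=
  forall A, facet A -> A `&` Y !=set0 -> closure A `<=` Y.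

(* An orientation is represented by the set of positive (q+1)-tuples of      *)
(* points of the closed facet, i.e. by a class of affine frames. A 0-facet   *)
(* has exactly one orientation.                                              *)
Definition positive_frames (q : nat) (P : set 'rV[R]_q) (chi : 'rV[R]_q -> X) :
    set ('I_q.+1 -> X) :=
  [set t | exists u : 'I_q.+1 -> 'rV[R]_q,
    [/\ forall i, P (u i), t = chi \o u
      & 0 < \det (\matrix_(i < q) (u (lift ord0 i) - u ord0))]].

Definition oriented_facet (q : nat) : set (set X * set ('I_q.+1 -> X)) :=
  [set Fc | facet Fc.1 /\
    exists P chi, is_chart Fc.1 P chi /\ Fc.2 = positive_frames P chi].

(* Meaningful for q > 0 only. *)
Definition opp_orientation (q : nat) (c : set ('I_q.+1 -> X)) :
    set ('I_q.+1 -> X) :=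
  [set t : 'I_q.+1 -> X | c (t \o tperm ord0 (inord 1))].

(* (F, c) induces the orientation c' on the face F' of codimension 1: a      *)
(* positive frame of F' preceded by a point of F is a positive frame of F.   *)
Definition induces (q : nat) (Fc : set X * set ('I_q.+2 -> X))
    (Fc' : set X * set ('I_q.+1 -> X)) : Prop :=
  forall x t, Fc.1 x -> Fc'.2 t ->
    Fc.2 (fun i => if unlift ord0 i is Some j then t j else x).

End Polysimplices.

Section Geodesics.
Variables (R : realType) (X : metricType R).

Definition is_geodesic (x y : X) (gamma : R -> X) : Prop :=
  [/\ gamma 0 = x, gamma (mdist x y) = y
    & forall s t, 0 <= s <= mdist x y -> 0 <= t <= mdist x y ->
        mdist (gamma s) (gamma t) = `|s - t|].

Definition uniquely_geodesic : Prop :=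
  forall x y, (exists gamma, is_geodesic x y gamma) /\
    forall gamma gamma', is_geodesic x y gamma -> is_geodesic x y gamma' ->
      forall t, 0 <= t <= mdist x y -> gamma t = gamma' t.

Definition geodesically_convex (Y : set X) : Prop :=
  forall x y gamma, Y x -> Y y -> is_geodesic x y gamma ->
    forall t, 0 <= t <= mdist x y -> Y (gamma t).

Definition convex_hull (Y : set X) : set X :=
  [set x | forall Z, geodesically_convex Z -> Y `<=` Z -> Z x].

Variable facet : set (set X).

Definition subcomplex_hull (Y : set X) : set X :=
  [set x | forall Z, is_subcomplex facet Z -> Y `<=` Z -> Z x].

Fixpoint hull_stage (o : X) (r : R) (n : nat) : set X :=
  if n is n'.+1 then subcomplex_hull (convex_hull (hull_stage o r n'))
  else [set x | mdist o x <= r].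

(* X^r: the stages increase, so this is the stage at which they stabilize. *)
Definition Xr (o : X) (r : R) : set X := \bigcup_n hull_stage o r n.

End Geodesics.

(* The semisimple Bruhat-Tits building enters through its polysimplicial     *)
(* structure, metric and G-action. bt_stabilizes is the finiteness fact that *)
(* makes X^r well defined.                                                   *)
Record building (R : realType) (G : ptopGroupType) (d : nat) := {
  bt_space :> metricType R;
  bt_facet : set (set bt_space);
  bt_act : G -> bt_space -> bt_space;
  bt_complex : is_polysimplicial_complex bt_facet d;
  bt_geodesic : uniquely_geodesic bt_space;
  bt_stabilizes : forall o r, 0 <= r -> exists n,
    hull_stage bt_facet o r n.+1 = hull_stage bt_facet o r n /\
    finite_set [set A | bt_facet A /\ A `<=` hull_stage bt_facet o r n];
  bt_act1 : forall x, bt_act 1%g x = x;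
  bt_actM : forall g h x, bt_act (g * h)%g x = bt_act g (bt_act h x);
  bt_act_isometric : forall g x y, mdist (bt_act g x) (bt_act g y) = mdist x y;
  bt_act_facet : forall g A, bt_facet A -> bt_facet (bt_act g @` A) }.

Record schneider_stuhler_groups (R : realType) (G : ptopGroupType) (d : nat)
    (X : building R G d) := {
  ss_group :> set X -> nat -> set G;
  ss_subgroup : forall F e, bt_facet F -> is_subgroup (ss_group F e);
  ss_open : forall F e, bt_facet F -> open (ss_group F e);
  ss_compact : forall F e, bt_facet F -> compact (ss_group F e);
  ss_normal : forall F e g u, bt_facet F -> bt_act g @` F = F ->
    ss_group F e u -> ss_group F e (g * u * g^-1)%g;
  ss_fixes : forall F e u x, bt_facet F -> ss_group F e u -> F x ->
    bt_act u x = x;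
  ss_conj : forall F e g, bt_facet F ->
    [set (g * u * g^-1)%g | u in ss_group F e] = ss_group (bt_act g @` F) e;
  ss_fundamental : forall F (N : set G), bt_facet F -> nbhs (1%g : G) N ->
    exists e, ss_group F e `<=` N;
  ss_face : forall F F' e, bt_facet F -> bt_facet F' -> F' `<=` closure F ->
    ss_group F' e `<=` ss_group F e }.

(* Maps on X_(q), extended by 0 to all pairs. *)
Notation chain_map X V q := ((set X * set ('I_q.+1 -> X))%type -> V).

Section Chains.
Variables (R : realType) (G : ptopGroupType) (d : nat) (X : building R G d).
Variable U : schneider_stuhler_groups X.
Variables (V : lmodType R[i]) (pi : representation G V) (e : nat).

Definition chains (q : nat) : set (chain_map X V q) :=
  [set w | [/\ forall Fc, ~ oriented_facet (@bt_facet _ _ _ X) Fc -> w Fc = 0,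
      finite_set [set Fc | w Fc <> 0],
      forall Fc, oriented_facet (@bt_facet _ _ _ X) Fc ->
        fixed_vectors pi (U Fc.1 e) (w Fc)
    & (0 < q)%N -> forall Fc, oriented_facet (@bt_facet _ _ _ X) Fc ->
        w (Fc.1, opp_orientation Fc.2) = - w Fc]].

Definition translate (q : nat) (g : G) (w : chain_map X V q) : chain_map X V q :=
  fun Fc => pi g (w (bt_act g^-1%g @` Fc.1,
                     [set @bt_act _ _ _ X g^-1%g \o t | t in Fc.2])).

Definition chain_op (mu : {measure set (borel G) -> \bar R}) (f : G -> R[i])
    (q : nat) (w : chain_map X V q) : chain_map X V q :=
  integral_lc mu (fun g => f g *: translate g w : chain_map X V q).

Definition boundary (q : nat) (w : chain_map X V q.+1) : chain_map X V q :=
  fun Fc' => if `[< oriented_facet (@bt_facet _ _ _ X) Fc' >] then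
    \sum_(Fc \in [set Fc | [/\ oriented_facet (@bt_facet _ _ _ X) Fc,
        Fc'.1 `<=` closure Fc.1 & induces Fc Fc']]) w Fc
  else 0.

Definition augmentation (w : chain_map X V 0) : V :=
  \sum_(Fc \in oriented_facet (@bt_facet _ _ _ X) (q := 0)) w Fc.

Definition cycles (q : nat) : set (chain_map X V q) :=
  match q return set (chain_map X V q) with
  | 0 => @chains 0
  | q'.+1 => [set w | chains w /\ boundary w = 0]
  end.

Definition boundaries (q : nat) : set (chain_map X V q) :=
  @boundary q @` @chains q.+1.

(* Exactness of 0 -> C_d -> ... -> C_0 -> V -> 0. For q = d this includes    *)
(* injectivity of the boundary on C_d, since C_(d+1) = 0.                    *)
Definition is_exact : Prop :=
  [/\ augmentation @` @chains 0 = setT,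
      [set w | chains w /\ augmentation w = 0] = @boundaries 0
    & forall q, (0 < q <= d)%N -> @cycles q = @boundaries q].

Definition truncation (o : X) (r : R) (q : nat) (w : chain_map X V q) :
    chain_map X V q :=
  fun Fc => if `[< Fc.1 `<=` Xr (@bt_facet _ _ _ X) o r >] then w Fc else 0.

(* H' q and B' q stand for H'_q and B'_{q-1}. *)
Variables H' B' : forall q, set (chain_map X V q).

Definition is_decomposition : Prop :=
  forall q, (q <= d)%N ->
    is_complement (@B' q) (@cycles q) (@chains q) /\
    is_complement (@H' q) (@boundaries q) (@cycles q).

Definition proj_B (q : nat) (w : chain_map X V q) : chain_map X V q :=
  (components (@boundaries q) (@H' q) (@B' q) w).1.1.
Definition proj_H' (q : nat) (w : chain_map X V q) : chain_map X V q :=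
  (components (@boundaries q) (@H' q) (@B' q) w).1.2.
Definition proj_B' (q : nat) (w : chain_map X V q) : chain_map X V q :=
  (components (@boundaries q) (@H' q) (@B' q) w).2.

(* The operator on B'_{q-1} corresponding, through the isomorphism           *)
(* boundary : B'_{q-1} -> B_{q-1}, to b |-> p_B Q_{q-1}^r b. B'_{-1} = 0.    *)
Definition tilde_truncation (o : X) (r : R) (q : nat) :
    chain_map X V q -> chain_map X V q :=
  match q return chain_map X V q -> chain_map X V q with
  | 0 => fun=> 0
  | q'.+1 => fun b' => xget 0 [set b'' | B' b'' /\
      boundary b'' = proj_B (truncation o r (boundary b'))]
  end.

(* The modified truncation operator on B_q, H'_q and B'_{q-1}, extended by   *)
(* linearity.                                                                *)
Definition modified_truncation (o : X) (r : R) (q : nat) (w : chain_map X V q) :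
    chain_map X V q :=
  let b := proj_B w in let h := proj_H' w in let b' := proj_B' w in
  proj_B (truncation o r b)
  + (proj_B (truncation o r h) + proj_H' (truncation o r h))
  + (proj_B (truncation o r b') + proj_H' (truncation o r b')
     + tilde_truncation o r b').

End Chains.

Arguments chains {R G d X} U {V} pi e q _.
Arguments cycles {R G d X} U {V} pi e q _.
Arguments boundaries {R G d X} U {V} pi e q _.
Arguments modified_truncation {R G d X} U {V} pi e H' B' o r q w.

(* Main.v *)
Require Import Defs.
From mathcomp Require Import all_boot all_order all_algebra all_field.
From mathcomp Require Import perm.
From mathcomp Require Import all_classical all_reals all_analysis.
From mathcomp Require Import complex finmap ring lra.
Set Implicit Arguments.
Unset Strict Implicit.
Unset Printing Implicit Defensive.
Import Order.TTheory GRing.Theory Num.Theory.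
Import numFieldNormedType.Exports.
Local Open Scope classical_set_scope.
Local Open Scope ring_scope.

(** All operators respect the filtrations B_q <= Z_q <= C_q, and the trace of a
    finite-rank operator is additive along exact sequences.  As the boundary
    identifies C_q / Z_q with B_(q-1), and exactness gives Z_q = B_q for q > 0 and
    C_0 / B_0 = V, the trace of T_f Qbar_q on C_q is beta_q + beta_(q-1), and
    beta_0 + tau for q = 0, where beta_q is the trace of T_f p_B Q_q on B_q and tau
    that of pi(f) o eps o Q_0 o s on V, with s : V -> H'_0 the inverse of eps.  The
    alternating sum telescopes to tau since B_d = 0.  Finally pi(f) maps V into the
    finite-dimensional space of vectors fixed by some compact open subgroup, and
    Q_0^r fixes the lifts of a basis of this space once r is large; hence
    tau = trace(pi(f); V). *)

(** * Traces of finite-rank operators *)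

(** The complements H'_q and B'_(q-1) need not be stable under G, so T_f respects only the
    filtrations and every trace has to be read on subquotients. Plain truncation is no better, since
    Q_q need not commute with the boundary. Qbar_q is built so that composing it with the boundary
    gives p_B Q_(q-1) after the boundary, and this holds for every r >= 0. The size of r matters in
    degree 0 only, where tau is compared with the trace of pi(f).

    Spaces are subsets of larger function spaces, and sums over facets or values fall back to 0 when
    infinitely many terms are nonzero. Linearity is therefore always relative to a subspace. As
    [trace] is defined by choice, each trace must be exhibited by an independent family and a
    matrix, and shown to be unique.

    Two finiteness facts carry analytic content: a facet has finitely many orientations although any
    chart may define one, and a test function is left invariant under a neighborhood of 1, which
    rests on the continuity of translations in G. *)

Definition lin_on (C : fieldType) (M N : lmodType C) (S : set M) (g : M -> N) :=
  forall a x y, S x -> S y -> g (a *: x + y) = a *: g x + g y.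

Definition lin_span (C : fieldType) (M : lmodType C) n (b : 'I_n -> M) : set M :=
  [set x | exists c : 'I_n -> C, x = \sum_i c i *: b i].

Definition independent (C : fieldType) (M : lmodType C) n (b : 'I_n -> M) :=
  forall c : 'I_n -> C, \sum_i c i *: b i = 0 -> forall i, c i = 0.

Definition findim (C : fieldType) (M : lmodType C) (S : set M) :=
  exists n (b : 'I_n -> M), S `<=` lin_span b.

Definition cat_family (T : Type) n m (b : 'I_n -> T) (c : 'I_m -> T) (i : 'I_(n + m)) :=
  match fintype.split i with inl j => b j | inr k => c k end.

Lemma cat_familyl (T : Type) n m (b : 'I_n -> T) (c : 'I_m -> T) i :
  cat_family b c (lshift m i) = b i.
Proof. by rewrite /cat_family -[lshift m i]/(unsplit (inl i)) unsplitK. Qed.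

Lemma cat_familyr (T : Type) n m (b : 'I_n -> T) (c : 'I_m -> T) i :
  cat_family b c (rshift n i) = c i.
Proof. by rewrite /cat_family -[rshift n i]/(unsplit (inr i)) unsplitK. Qed.

Section Subspaces.
Variables (C : fieldType) (M N : lmodType C).
Implicit Types (S W : set M) (g : M -> N).

Lemma subspace0 S : is_subspace S -> S 0. Proof. by case. Qed.

Lemma subspaceD S x y : is_subspace S -> S x -> S y -> S (x + y).
Proof. by move=> [_ h] Sx Sy; rewrite -[x]scale1r; apply: h. Qed.

Lemma subspaceZ S a x : is_subspace S -> S x -> S (a *: x).
Proof. by move=> [h0 h] Sx; rewrite -[_ *: _]addr0; apply: h. Qed.

Lemma subspaceN S x : is_subspace S -> S x -> S (- x).
Proof. by move=> hS Sx; rewrite -scaleN1r; apply: subspaceZ. Qed.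

Lemma subspaceB S x y : is_subspace S -> S x -> S y -> S (x - y).
Proof. by move=> hS Sx Sy; apply: subspaceD => //; apply: subspaceN. Qed.

Lemma subspace_sum S (I : Type) (r : seq I) (P : pred I) (F : I -> M) :
  is_subspace S -> (forall i, P i -> S (F i)) -> S (\sum_(i <- r | P i) F i).
Proof.
move=> hS hF; elim/big_ind: _ => //; first exact: subspace0.
by move=> x y; apply: subspaceD.
Qed.

Lemma lin_on0 S g : is_subspace S -> lin_on S g -> g 0 = 0.
Proof.
move=> [S0 _] hg; have := hg 1 0 0 S0 S0.
by rewrite scaler0 addr0 scale1r -[LHS]addr0 => /addrI <-.
Qed.

Lemma lin_onD S g x y : lin_on S g -> S x -> S y -> g (x + y) = g x + g y.
Proof. by move=> hg Sx Sy; have := hg 1 x y Sx Sy; rewrite !scale1r. Qed.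

Lemma lin_onZ S g a x : is_subspace S -> lin_on S g -> S x -> g (a *: x) = a *: g x.
Proof.
move=> hS hg Sx; have := hg a x 0 Sx (subspace0 hS).
by rewrite !addr0 (lin_on0 hS hg) addr0.
Qed.

Lemma lin_onB S g x y : is_subspace S -> lin_on S g -> S x -> S y ->
  g (x - y) = g x - g y.
Proof.
move=> hS hg Sx Sy; rewrite (lin_onD hg)//; last exact: subspaceN.
by rewrite -scaleN1r (lin_onZ _ hS hg)// scaleN1r.
Qed.

Lemma lin_on_sum S g (I : Type) (r : seq I) (c : I -> C) (F : I -> M) :
  is_subspace S -> lin_on S g -> (forall i, S (F i)) ->
  g (\sum_(i <- r) c i *: F i) = \sum_(i <- r) c i *: g (F i).
Proof.
move=> hS hg hF; elim: r => [|i r IH]; first by rewrite !big_nil (lin_on0 hS hg).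
rewrite !big_cons hg ?IH//.
by apply: subspace_sum => // j _; apply: subspaceZ.
Qed.

Lemma subspace_image S g : is_subspace S -> lin_on S g -> is_subspace (g @` S).
Proof.
move=> hS hg; split; first by exists 0; [exact: subspace0 | exact: lin_on0 hg].
move=> a _ _ [x Sx <-] [y Sy <-]; exists (a *: x + y); last by rewrite hg.
by case: hS => _; apply.
Qed.

Lemma subspace_ker S g : is_subspace S -> lin_on S g ->
  is_subspace [set x | S x /\ g x = 0].
Proof.
move=> hS hg; split; first by split; [exact: subspace0 | exact: lin_on0 hg].
move=> a x y [Sx gx] [Sy gy]; split; first by case: hS => _; apply.
by rewrite hg// gx gy scaler0 addr0.
Qed.

Lemma subspace_span n (b : 'I_n -> M) : is_subspace (lin_span b).
Proof.
split; first by exists (fun=> 0); rewrite big1// => i _; rewrite scale0r.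
move=> a x y [c ->] [c' ->]; exists (fun i => a * c i + c' i).
rewrite scaler_sumr -big_split; apply: eq_bigr => i _ /=.
by rewrite scalerDl scalerA.
Qed.

(** Expressing the [c i] through [b] gives an m x n matrix. If n < m, a nonzero row of its left
    kernel is a nontrivial relation between the [c i]. *)
Lemma independent_size n m (b : 'I_n -> M) (c : 'I_m -> M) :
  (forall i, lin_span b (c i)) -> independent c -> (m <= n)%N.
Proof.
move=> /choice [A hA] indc; rewrite leqNgt; apply/negP => ltnm.
pose B : 'M[C]_(m, n) := \matrix_(i, j) A i j.
have ker_neq0 : kermx B != 0.
  by rewrite -mxrank_eq0 mxrank_ker subn_eq0 -ltnNge (leq_ltn_trans _ ltnm)// rank_leq_col.
pose r := nz_row (kermx B).
have rB : r *m B = 0 by apply/eqP; rewrite -sub_kermx nz_row_sub.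
have /eqP := ker_neq0; apply; apply/eqP; rewrite -nz_row_eq0; apply/eqP/rowP => i.
rewrite mxE; apply: (indc (fun j => r 0 j)).
under eq_bigr => j _ do rewrite hA scaler_sumr.
rewrite exchange_big big1//= => j _.
transitivity ((r *m B) 0 j *: b j); last by rewrite rB mxE scale0r.
rewrite mxE scaler_suml; by apply: eq_bigr => k _; rewrite scalerA !mxE.
Qed.

(** By [independent_size] there is an independent family in [S] of maximal length; a vector outside
    its span would extend it. *)
Lemma findim_basis S : is_subspace S -> findim S ->
  exists m (c : 'I_m -> M), [/\ forall i, S (c i), independent c & S `<=` lin_span c].
Proof.
move=> hS [n [b Sb]].
pose P m := `[< exists c : 'I_m -> M, (forall i, S (c i)) /\ independent c >].
have P0 : exists m, P m.
  exists 0%N; apply/asboolP; exists (fun=> 0); split; first by case.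
  by move=> c _ [].
have Pn m : P m -> (m <= n)%N.
  by move=> /asboolP[c [Sc]]; apply: independent_size => i; apply: Sb.
case: (ex_maxnP P0 Pn) => m /asboolP[c [Sc indc]] maxm.
exists m, c; split => // x Sx; apply: contrapT => nspan.
have : P m.+1; last by move/maxm; rewrite ltnn.
apply/asboolP; exists (fun i => if unlift ord0 i is Some j then c j else x).
split=> [i|a]; first by case: unliftP.
rewrite big_ord_recl unlift_none; under eq_bigr do rewrite liftK.
move=> ha; have a0 : a ord0 = 0.
  apply: contrapT => /eqP a0; apply: nspan.
  exists (fun j => - (a ord0)^-1 * a (lift ord0 j)).
  under eq_bigr do rewrite -scalerA.
  rewrite -scaler_sumr scaleNr -scalerN; apply: (scalerI a0).
  by rewrite scalerA divff// scale1r; apply/eqP; rewrite -addr_eq0 ha.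
move=> i; case: (unliftP ord0 i) => [j ->|->//].
by apply: (indc (fun j => a (lift ord0 j))); move: ha; rewrite a0 scale0r add0r.
Qed.

Lemma findimS S S' : S `<=` S' -> findim S' -> findim S.
Proof. by move=> sub [n [b hb]]; exists n, b; apply: subset_trans hb. Qed.

Lemma findim_add S S' : findim S -> findim S' ->
  findim [set z | exists x y, [/\ S x, S' y & z = x + y]].
Proof.
move=> [n [b hb]] [m [c hc]].
exists (n + m)%N, (cat_family b c).
move=> _ [x [y [/hb[s ->] /hc[t ->] ->]]]; exists (cat_family s t).
rewrite big_split_ord; congr (_ + _); apply: eq_bigr => i _.
  by rewrite !cat_familyl.
by rewrite !cat_familyr.
Qed.

End Subspaces.

Lemma findim_image (C : fieldType) (M N : lmodType C) (S : set M) (g : M -> N) :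
  is_subspace S -> lin_on S g -> findim S -> findim (g @` S).
Proof.
move=> hS hg /(findim_basis hS)[n [b [Sb _ hb]]]; exists n, (g \o b).
move=> _ [x /hb[c ->] <-]; exists c.
by rewrite (lin_on_sum _ _ hS).
Qed.

Section Trace.
Variables (C : fieldType) (M : lmodType C).
Implicit Types (W : set M) (T : M -> M).

(** The family in [is_trace] may span more than the image of [T]. With [c] a basis of the image, its
    matrix factors as [a = A' *m B'], while [B' *m A'] is the matrix of [T] on [c], which no longer
    depends on the family. The two products have the same trace. *)
Lemma is_trace_uniq W T t t' : is_subspace W -> lin_on W T ->
  is_trace W T t -> is_trace W T t' -> t = t'.
Proof.
move=> hW hT tr_t tr_t'.
have [m [c [Ic indc spanc]]] : exists m (c : 'I_m -> M),
    [/\ forall i, (T @` W) (c i), independent c & T @` W `<=` lin_span c].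
  apply: findim_basis; first exact: subspace_image.
  case: tr_t => n [b [a [_ _ hb _ _]]]; exists n, b => _ [w /hb + <-]; exact.
suff key s : is_trace W T s -> exists2 A : 'M[C]_m,
    (forall k, T (c k) = \sum_l A k l *: c l) & s = \tr A.
  have [A hA ->] := key _ tr_t; have [A' hA' ->] := key _ tr_t'; congr (\tr _).
  apply/matrixP => k l; apply/eqP; rewrite -subr_eq0; apply/eqP; move: l.
  apply: indc; under eq_bigr do rewrite scalerBl.
  by rewrite sumrB -hA -hA' subrr.
case=> n [b [a [Wb indb hb ab ->]]].
have /choice[A hA] i : exists f : 'I_m -> C, T (b i) = \sum_k f k *: c k.
  by apply: spanc; exists (b i).
have /choice[B hB] k : exists f : 'I_n -> C, c k = \sum_i f i *: b i.
  by have [w Ww <-] := Ic k; apply: hb.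
pose A' : 'M[C]_(n, m) := \matrix_(i, k) A i k.
pose B' : 'M[C]_(m, n) := \matrix_(k, i) B k i.
have -> : a = A' *m B'.
  apply/matrixP => i j; apply/eqP; rewrite -subr_eq0; apply/eqP; move: j.
  apply: indb; under eq_bigr do rewrite scalerBl.
  rewrite sumrB -ab hA; apply/eqP; rewrite subr_eq0; apply/eqP.
  under eq_bigr do rewrite hB scaler_sumr.
  rewrite exchange_big; apply: eq_bigr => j _ /=; rewrite mxE scaler_suml.
  by apply: eq_bigr => k _; rewrite scalerA !mxE.
exists (B' *m A'); last by rewrite mxtrace_mulC.
move=> k; rewrite [in LHS]hB (lin_on_sum _ _ hW)//.
under eq_bigr do rewrite hA scaler_sumr.
rewrite exchange_big; apply: eq_bigr => j _ /=; rewrite mxE scaler_suml.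
by apply: eq_bigr => i _; rewrite scalerA !mxE.
Qed.

Lemma traceE W T t : is_subspace W -> lin_on W T -> is_trace W T t ->
  trace W T = t.
Proof.
move=> hW hT ht; apply: (is_trace_uniq hW hT) => //.
exact: xgetPex (ex_intro _ t ht).
Qed.

Lemma eq_is_trace W T T' t : (forall w, W w -> T w = T' w) ->
  is_trace W T t -> is_trace W T' t.
Proof.
move=> eqT [n [b [a [Wb indb hb ab ->]]]]; exists n, b, a; split => //.
  by move=> w Ww; rewrite -eqT//; apply: hb.
by move=> i; rewrite -eqT.
Qed.

End Trace.

(** Everything takes place in the finite-dimensional space [E], the image of [T], which [T]
    preserves. A basis [b1] of the kernel of [L] in [E] and lifts [s] of a basis [b2] of [L(E)]
    together form a basis of [E]. The span of [b1] contains the image under [T] of the kernel of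
    [L], and [L(E)] is the image of [T2], so these families compute all three traces. *)
Lemma is_trace_exact (C : fieldType) (M N : lmodType C) (W : set M) (W2 : set N)
    (L : M -> N) (T : M -> M) (T2 : N -> N) :
  is_subspace W -> lin_on W L -> L @` W = W2 -> lin_on W T ->
  (forall w, W w -> W (T w)) -> (forall w, W w -> L (T w) = T2 (L w)) ->
  findim (T @` W) ->
  exists t1 t2, [/\ is_trace [set w | W w /\ L w = 0] T t1, is_trace W2 T2 t2
    & is_trace W T (t1 + t2)].
Proof.
move=> hW hL <-{W2} hT WT LT fdT.
have hE := subspace_image hW hT; set E := T @` W in hE fdT.
have EW : E `<=` W by move=> _ [w Ww <-]; apply: WT.
have LE : lin_on E L by move=> a x y /EW Wx /EW Wy; apply: hL.
have TE : lin_on E T by move=> a x y /EW Wx /EW Wy; apply: hT.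
have [n1 [b1 [Eb1 ind1 sp1]]] := findim_basis (subspace_ker hE LE)
  (findimS (@subIsetl _ E _) fdT).
have [n2 [b2 [Eb2 ind2 sp2]]] := findim_basis (subspace_image hE LE)
  (findim_image hE LE fdT).
have /choice[s hs] k : exists x, E x /\ L x = b2 k.
  by have [x Ex <-] := Eb2 k; exists x.
have Es k : E (s k) by case: (hs k).
have Ls k : L (s k) = b2 k by case: (hs k).
have E1 i : E (b1 i) by case: (Eb1 i).
have L1 i : L (b1 i) = 0 by case: (Eb1 i).
have spE x : E x -> exists c1 c2, L x = \sum_k c2 k *: b2 k /\
    x = \sum_i c1 i *: b1 i + \sum_k c2 k *: s k.
  move=> Ex; have [c2 hc2] : lin_span b2 (L x) by apply: sp2; exists x.
  have Ey : E (\sum_k c2 k *: s k).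
    by apply: subspace_sum => // k _; apply: subspaceZ.
  have [c1 hc1] : lin_span b1 (x - \sum_k c2 k *: s k).
    apply: sp1; split; first exact: subspaceB.
    rewrite (lin_onB hE LE)// (lin_on_sum _ _ hE LE)// hc2.
    by under [X in _ - X]eq_bigr do rewrite Ls; rewrite subrr.
  by exists c1, c2; rewrite -hc1 subrK.
have /choice[a1 ha1] i : exists f : 'I_n1 -> C, T (b1 i) = \sum_k f k *: b1 k.
  apply: sp1; split; first by exists (b1 i) => //; apply: EW.
  by rewrite LT ?L1; [rewrite -(lin_on0 hW hL) -LT ?(lin_on0 hW hT)//; exact: subspace0|exact: EW].
have /choice[a2 ha2] k : exists f : ('I_n1 -> C) * ('I_n2 -> C),
    L (T (s k)) = \sum_l f.2 l *: b2 l /\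
    T (s k) = \sum_i f.1 i *: b1 i + \sum_l f.2 l *: s l.
  have /spE[c1 [c2 h]] : E (T (s k)) by exists (s k) => //; apply: EW.
  by exists (c1, c2).
pose A1 := \matrix_(i, j) a1 i j; pose A2 := \matrix_(i, j) (a2 i).2 j.
exists (\tr A1), (\tr A2); split.
- exists n1, b1, A1; split => //.
  + by move=> i; split; [apply: EW|].
  + move=> w [Ww Lw]; apply: sp1; split; first by exists w.
    by rewrite LT// Lw -(lin_on0 hW hL) -LT ?(lin_on0 hW hT)//; exact: subspace0.
  + by move=> i; rewrite ha1; apply: eq_bigr => j _; rewrite mxE.
- exists n2, b2, A2; split => //.
  + by move=> i; exists (s i) => //; apply: EW.
  + by move=> _ [w Ww <-]; rewrite -LT//; apply: sp2; exists (T w) => //; exists w.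
  + move=> i; rewrite -Ls -LT; last exact: EW.
    by rewrite (ha2 i).1; apply: eq_bigr => j _; rewrite mxE.
pose A12 := \matrix_(i, j) (a2 i).1 j.
pose b := cat_family b1 s.
have bl i : b (lshift n2 i) = b1 i by rewrite /b cat_familyl.
have br i : b (rshift n1 i) = s i by rewrite /b cat_familyr.
have sumb (c : 'I_(n1 + n2) -> C) : \sum_i c i *: b i =
    \sum_i c (lshift n2 i) *: b1 i + \sum_k c (rshift n1 k) *: s k.
  by rewrite big_split_ord; congr (_ + _); apply: eq_bigr => i _; rewrite ?bl ?br.
(* Rows hold the images of the basis vectors. As [T] preserves the kernel of [L], the images of [b1]
   have no component along [s], whence the zero block. *)
exists (n1 + n2)%N, b, (block_mx A1 0 A12 A2); split => //.
- by move=> i; rewrite /b /cat_family; case: fintype.split => j; apply: EW.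
- move=> c; rewrite sumb => hc.
  have c2 : forall k, c (rshift n1 k) = 0.
    apply: ind2; have := congr1 L hc; rewrite (lin_onD hL); last 2 first.
    + by apply: subspace_sum => // k _; apply: subspaceZ => //; apply: EW.
    + by apply: subspace_sum => // k _; apply: subspaceZ => //; apply: EW.
    rewrite (lin_on0 hW hL) !(lin_on_sum _ _ hE LE)//.
    under eq_bigr do rewrite L1 scaler0.
    by rewrite big1_eq add0r; under eq_bigr do rewrite Ls.
  have c1 : forall k, c (lshift n2 k) = 0.
    apply: ind1; move: hc; rewrite [X in _ + X]big1 ?addr0// => k _.
    by rewrite c2 scale0r.
  by move=> i; rewrite -(splitK i); case: fintype.split => j; rewrite /= ?c1 ?c2.
- move=> w Ww; have [c1 [c2 [_ ->]]] : exists c1 c2, L (T w) = \sum_k c2 k *: b2 k /\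
     T w = \sum_i c1 i *: b1 i + \sum_k c2 k *: s k by apply: spE; exists w.
  exists (cat_family c1 c2).
  rewrite sumb; congr (_ + _); apply: eq_bigr => i _.
    by rewrite cat_familyl.
  by rewrite cat_familyr.
- move=> i; rewrite sumb -(splitK i); case: fintype.split => j /=.
    rewrite bl ha1 [X in _ + X]big1 ?addr0.
      by apply: eq_bigr => k _; rewrite block_mxEul mxE.
    by move=> k _; rewrite block_mxEur mxE scale0r.
  rewrite br (ha2 j).2; congr (_ + _); apply: eq_bigr => k _.
    by rewrite block_mxEdl mxE.
  by rewrite block_mxEdr mxE.
- by rewrite mxtrace_block.
Qed.

(** * Endomorphisms of a subspace and their ranges *)

Section Endomorphisms.
Variables (C : fieldType) (M : lmodType C).
Implicit Types (S : set M) (T : M -> M).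

Definition endo_on S T := lin_on S T /\ forall x, S x -> S (T x).

Lemma endo_on_comp S T T' : endo_on S T -> endo_on S T' -> endo_on S (T \o T').
Proof.
move=> [lT ST] [lT' ST']; split=> [a x y Sx Sy|x Sx] /=.
  by rewrite lT'// lT//; apply: ST'.
by apply: ST; apply: ST'.
Qed.

Lemma endo_on_add S T T' : is_subspace S -> endo_on S T -> endo_on S T' ->
  endo_on S (fun x => T x + T' x).
Proof.
move=> hS [lT ST] [lT' ST']; split=> [a x y Sx Sy|x Sx].
  by rewrite lT// lT'// scalerDr addrACA.
by apply: subspaceD => //; [apply: ST|apply: ST'].
Qed.

Lemma endo_on0 S : is_subspace S -> endo_on S (fun=> 0).
Proof.
by move=> hS; split=> [a x y _ _|x _]; [rewrite scaler0 addr0|exact: subspace0].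
Qed.

Lemma subspace_range S T : is_subspace S -> endo_on S T -> is_subspace (T @` S).
Proof. by move=> hS [lT _]; exact: subspace_image. Qed.

Lemma range_sub S T : endo_on S T -> T @` S `<=` S.
Proof. by move=> [_ ST] _ [x Sx <-]; apply: ST. Qed.

Lemma findim_range_comp S T1 T T2 : is_subspace S -> endo_on S T1 -> endo_on S T ->
  endo_on S T2 -> findim (T @` S) -> findim ((T1 \o T \o T2) @` S).
Proof.
move=> hS [l1 _] hT [_ S2] fT; apply: (@findimS _ _ _ (T1 @` (T @` S))).
  by move=> _ [x Sx <-]; exists (T (T2 x)) => //; exists (T2 x) => //; apply: S2.
apply: findim_image fT; first exact: subspace_range.
by move=> a x y Tx Ty; apply: l1; apply: (range_sub hT).
Qed.

Lemma findim_range_add S T T' : findim (T @` S) -> findim (T' @` S) ->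
  findim ((fun x => T x + T' x) @` S).
Proof.
move=> fT fT'; apply: findimS (findim_add fT fT').
by move=> _ [x Sx <-]; exists (T x), (T' x); split => //; exists x.
Qed.

End Endomorphisms.

Lemma findim_inj (C : fieldType) (M N : lmodType C) (S : set M) (L : M -> N) :
  is_subspace S -> lin_on S L -> (forall x, S x -> L x = 0 -> x = 0) ->
  findim (L @` S) -> findim S.
Proof.
move=> hS hL inj /(findim_basis (subspace_image hS hL))[n [b [Lb _ hb]]].
have /choice[s hs] i : exists x, S x /\ L x = b i.
  by have [x Sx <-] := Lb i; exists x.
have Ss i : S (s i) by case: (hs i).
exists n, s => x Sx; have [c hc] : lin_span b (L x) by apply: hb; exists x.
exists c; apply/eqP; rewrite -subr_eq0; apply/eqP.
have Sc : S (\sum_i c i *: s i).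
  by apply: subspace_sum => // i _; apply: subspaceZ.
apply: inj; first exact: subspaceB.
rewrite (lin_onB hS hL)// (lin_on_sum _ _ hS hL)// hc.
by apply/eqP; rewrite subr_eq0; apply/eqP/eq_bigr => i _; case: (hs i) => _ ->.
Qed.

(** [T2] inherits linearity from [T], since every vector of its domain is some [L w]. This serves
    operators that are defined through an arbitrary choice of lifts. *)
Lemma lin_on_quotient (C : fieldType) (M N : lmodType C) (W : set M)
    (L : M -> N) (T : M -> M) (T2 : N -> N) :
  is_subspace W -> lin_on W L -> endo_on W T ->
  (forall w, W w -> L (T w) = T2 (L w)) -> lin_on (L @` W) T2.
Proof.
move=> hW hL [lT WT] LT a _ _ [x Wx <-] [y Wy <-].
have Wxy : W (a *: x + y) by case: hW => _; apply.
by rewrite -hL// -LT// lT// hL ?LT//; apply: WT.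
Qed.

(** * Projections of a two-step direct sum *)

Section Components.
Variables (C : fieldType) (M : lmodType C) (W1 W2 W3 Z W : set M).
Hypotheses (subZ : is_subspace Z) (sub1 : is_subspace W1).
Hypotheses (W1Z : W1 `<=` Z) (ZW : Z `<=` W).
Hypotheses (cZ : is_complement W2 W1 Z) (cW : is_complement W3 Z W).

Let sub2 : is_subspace W2. Proof. by case: cZ. Qed.
Let sub3 : is_subspace W3. Proof. by case: cW. Qed.

Lemma complement_inj A B D x : @is_complement C M A B D -> A x -> B x -> x = 0.
Proof.
move=> [_ _ BA _] Ax Bx.
have : (B `&` A) x by [].
by rewrite BA.
Qed.

(** As [components] picks some decomposition, the content is uniqueness: the [W3] parts of two
    decompositions differ by an element of [Z], hence agree, and then the [W2] parts differ by an
    element of [W1]. *)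
Lemma componentsE x y z : W1 x -> W2 y -> W3 z ->
  components W1 W2 W3 (x + y + z) = (x, y, z).
Proof.
move=> W1x W2y W3z; rewrite /components.
set P := [set _ | _].
have : P (xget (0, 0, 0) P) by apply: xgetPex; exists (x, y, z).
case: (xget _ _) => -[x' y'] z' [/= W1x' W2y' W3z' e].
have W2Z : W2 `<=` Z by case: cZ.
have ez : z - z' = (x' + y') - (x + y).
  apply/eqP; rewrite subr_eq addrAC eq_sym subr_eq; apply/eqP.
  by rewrite -e addrC.
have zz' : z - z' = 0.
  apply: (complement_inj cW); first exact: subspaceB.
  by rewrite ez; apply: subspaceB => //; apply: subspaceD; auto.
have ey : y - y' = x' - x.
  move: ez; rewrite zz' => /esym/eqP; rewrite subr_eq0 => /eqP exy.
  by apply/eqP; rewrite subr_eq addrAC exy addrAC subrr add0r.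
have yy' : y - y' = 0.
  apply: (complement_inj cZ); first exact: subspaceB.
  by rewrite ey; exact: subspaceB.
have := ey; rewrite yy' => /esym/eqP; rewrite subr_eq0 => /eqP ->.
move/eqP: yy'; rewrite subr_eq0 => /eqP ->.
by move/eqP: zz'; rewrite subr_eq0 => /eqP ->.
Qed.

Lemma componentsP w : W w -> exists x y z, [/\ W1 x, W2 y, W3 z & w = x + y + z].
Proof.
move=> Ww; have [_ _ _ /(_ w Ww)[z0 [z [Zz0 W3z ->]]]] := cW.
have [_ _ _ /(_ z0 Zz0)[x [y [W1x W2y ->]]]] := cZ.
by exists x, y, z.
Qed.

Let W1W : W1 `<=` W. Proof. exact: subset_trans ZW. Qed.
Let W2W : W2 `<=` W. Proof. by apply: subset_trans ZW; case: cZ. Qed.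
Let W3W : W3 `<=` W. Proof. by case: cW. Qed.

Lemma components_lin w w' a : W w -> W w' ->
  let c := components W1 W2 W3 w in let c' := components W1 W2 W3 w' in
  components W1 W2 W3 (a *: w + w') =
  (a *: c.1.1 + c'.1.1, a *: c.1.2 + c'.1.2, a *: c.2 + c'.2).
Proof.
move=> /componentsP[x [y [z [W1x W2y W3z ->]]]] /componentsP[x' [y' [z' [W1x' W2y' W3z' ->]]]].
rewrite /= !componentsE//= -componentsE.
- by rewrite !scalerDr addrACA [in LHS](addrACA (a *: x)).
- by case: sub1 => _; apply.
- by case: sub2 => _; apply.
- by case: sub3 => _; apply.
Qed.

Lemma endo_component1 : endo_on W (fun w => (components W1 W2 W3 w).1.1).
Proof.
split=> [a x y Wx Wy|_ /componentsP[x [y [z [W1x W2y W3z ->]]]]].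
  by rewrite components_lin.
by rewrite componentsE//; apply: W1W.
Qed.

Lemma endo_component2 : endo_on W (fun w => (components W1 W2 W3 w).1.2).
Proof.
split=> [a x y Wx Wy|_ /componentsP[x [y [z [W1x W2y W3z ->]]]]].
  by rewrite components_lin.
by rewrite componentsE//; apply: W2W.
Qed.

Lemma endo_component3 : endo_on W (fun w => (components W1 W2 W3 w).2).
Proof.
split=> [a x y Wx Wy|_ /componentsP[x [y [z [W1x W2y W3z ->]]]]].
  by rewrite components_lin.
by rewrite componentsE//; apply: W3W.
Qed.

End Components.

(** * Integrals of locally constant maps and smooth actions *)

Section Integral.
Local Open Scope complex_scope.
Variables (R : realType) (G : ptopGroupType).

Definition locally_constant (T : Type) (theta : G -> T) :=
  forall g, nbhs g [set h | theta h = theta g].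

(* [z] stands for the value off the support; it is a parameter so that pairs of
   compactly supported maps are covered. *)
Definition lc_compact (T : Type) (z : T) (theta : G -> T) :=
  locally_constant theta /\
  exists2 A : set G, compact A & forall g, ~ A g -> theta g = z.

Lemma lc_open (T : Type) (theta : G -> T) (A : set T) :
  locally_constant theta -> open (theta @^-1` A).
Proof.
move=> lc; rewrite openE => g Ag; apply: filterS (lc g) => h /=.
by rewrite /preimage /= => ->.
Qed.

(** The level sets are open and cover the compact set, so finitely many suffice; [z] is added to the
    list for the points outside it. *)
Lemma lc_compact_finite (T : choiceType) (z : T) (theta : G -> T) :
  lc_compact z theta -> exists r : seq T, [/\ uniq r, forall g, theta g \in r
    & forall t, t \in r -> t = z \/ exists g, theta g = t].
Proof.
move=> [lc [A cA A0]].
have := cA; rewrite compact_cover => /(_ G setT (fun g => theta @^-1` [set theta g])).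
case.
- by move=> g _; apply: lc_open.
- by move=> g Ag; exists g.
move=> D _ cov; exists (undup (z :: [seq theta g | g <- finmap.enum_fset D])).
split; first exact: undup_uniq.
  move=> g; rewrite mem_undup; case: (pselect (A g)) => [/cov[h Dh /= ->]|/A0 ->].
    by rewrite inE map_f ?orbT.
  by rewrite mem_head.
move=> t; rewrite mem_undup inE => /orP[/eqP ->|/mapP[g _ ->]]; first by left.
by right; exists g.
Qed.

Variable mu : {measure set (borel G) -> \bar R}.
Hypothesis hmu : is_haar mu.

Lemma open_measurable_borel (A : set G) : open A -> measurable (A : set (borel G)).
Proof. by move=> oA; apply: sub_sigma_algebra. Qed.

(** For [t <> z] the level set lies in the compact set, and it is closed because its complement is
    also a preimage, hence open. *)
Lemma lc_compact_mu (T : choiceType) (z : T) (theta : G -> T) t :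
  lc_compact z theta -> t <> z -> (mu (theta @^-1` [set t]) < +oo)%E.
Proof.
move=> [lc [A cA A0]] tz; apply: (haar_compact hmu); last first.
  by apply: open_measurable_borel; apply: lc_open.
apply: subclosed_compact cA _.
  by rewrite -openC preimage_setC; apply: lc_open.
by move=> g /= gt; apply: contrapT => /A0; rewrite gt.
Qed.

(** The level sets of [L \o theta] are finite disjoint unions of level sets of [theta], so the
    integral can be computed on the finer partition. With [theta] the integrand this gives
    commutation with linear maps; with [theta] a pair of integrands it gives linearity in the
    integrand. *)
Lemma integral_lc_comp (T : choiceType) (z : T) (theta : G -> T) (r : seq T)
    (M : lmodType R[i]) (L : T -> M) :
  lc_compact z theta -> L z = 0 -> uniq r -> (forall g, theta g \in r) ->
  integral_lc mu (L \o theta) =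
  \sum_(t <- r) (fine (mu (theta @^-1` [set t])))%:C *: L t.
Proof.
move=> lct Lz ur rP; rewrite /integral_lc.
pose s := undup (map L r); pose F w := (fine (mu ((L \o theta) @^-1` [set w])))%:C *: w.
have sub0 : [set w : M | w <> 0] `<=` setT by [].
rewrite (fsbig_widen _ _ _ sub0); last first.
  by move=> w [_ /= /contrapT ->]; rewrite scaler0.
have subs : [set` s] `<=` setT by [].
rewrite -(fsbig_widen _ _ _ subs); last first.
  move=> w [_ /=]; rewrite /s mem_undup => ws.
  suff -> : (L \o theta) @^-1` [set w] = set0 by rewrite measure0 scale0r.
  apply/seteqP; split => // g /= gw; apply: ws.
  by apply/mapP; exists (theta g).
rewrite -fsbig_seq ?undup_uniq//.
have muE w : w <> 0 -> mu ((L \o theta) @^-1` [set w]) =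
    (\sum_(t <- r | L t == w) mu (theta @^-1` [set t]))%E.
  move=> w0; rewrite -big_filter.
  have -> : (L \o theta) @^-1` [set w] =
      \bigcup_(t in [set` [seq t <- r | L t == w]]) (theta @^-1` [set t]).
    apply/seteqP; split => [g /= gw|g [t /=]].
      by exists (theta g) => //=; rewrite mem_filter rP gw eqxx.
    by rewrite mem_filter => /andP[/eqP <- _] <-.
  rewrite measure_fin_bigcup//.
  - by rewrite -fsbig_seq ?filter_uniq.
  - by move=> t t' _ _ [g [/= <- <-]].
  - by move=> t _; apply: open_measurable_borel; apply: lc_open; case: lct.
transitivity (\sum_(w <- s) \sum_(t <- r | L t == w)
    (fine (mu (theta @^-1` [set t])))%:C *: L t).
  apply: eq_bigr => w _; have [->|w0] := eqVneq w 0.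
    by rewrite scaler0 big1// => t /eqP ->; rewrite scaler0.
  rewrite muE; last exact/eqP.
  have -> : \sum_(t <- r | L t == w) (fine (mu (theta @^-1` [set t])))%:C *: L t =
    \sum_(t <- r | L t == w) (fine (mu (theta @^-1` [set t])))%:C *: w.
    by apply: eq_bigr => t /eqP ->.
  rewrite -scaler_suml; congr (_ *: _).
  (* Here [L t = w] is nonzero, so [t <> z] and the measure is finite; this is what makes [fine]
     additive. The level set of [z] itself may have infinite measure. *)
  rewrite -rmorph_sum /= sum_fine// => t /eqP Lt.
  rewrite ge0_fin_numE//; apply: lc_compact_mu lct _ => tz.
  by move: w0; rewrite -Lt tz Lz eqxx.
rewrite (exchange_big_dep predT)//=; apply: eq_big_seq => t tr.
have : L t \in s by rewrite mem_undup map_f.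
move=> Lts; rewrite -big_filter.
have -> : [seq i <- s | L t == i] = [:: L t].
  rewrite -(filter_pred1_uniq (undup_uniq _) Lts).
  by apply: eq_filter => x; rewrite /= eq_sym.
by rewrite big_seq1.
Qed.

Lemma lc_compact_pair (T T' : Type) (z : T) (z' : T') (theta : G -> T)
    (theta' : G -> T') : lc_compact z theta -> lc_compact z' theta' ->
  lc_compact (z, z') (fun g => (theta g, theta' g)).
Proof.
move=> [lc [A cA A0]] [lc' [A' cA' A0']]; split.
  by move=> g; apply: filterS2 (lc g) (lc' g) => h /= -> ->.
exists (A `|` A'); first exact: compactU.
by move=> g /not_orP[/A0 -> /A0' ->].
Qed.

Lemma integral_lc_in (M : lmodType R[i]) (S : set M) (phi : G -> M) :
  is_subspace S -> lc_compact 0 phi -> (forall g, S (phi g)) ->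
  S (integral_lc mu phi).
Proof.
move=> hS lcp Sp; have [r [ur rP rS]] := lc_compact_finite lcp.
rewrite -[phi]/(id \o phi) (integral_lc_comp lcp _ ur)//.
rewrite big_seq; apply: subspace_sum => // t /rS ht; apply: subspaceZ => //.
by case: ht => [->|[g <-]//]; apply: subspace0.
Qed.

Lemma integral_lc_lin (M N : lmodType R[i]) (S : set M) (L : M -> N) (phi : G -> M) :
  is_subspace S -> lin_on S L -> lc_compact 0 phi -> (forall g, S (phi g)) ->
  L (integral_lc mu phi) = integral_lc mu (L \o phi).
Proof.
move=> hS hL lcp Sp; have [r [ur rP rS]] := lc_compact_finite lcp.
rewrite (integral_lc_comp lcp (lin_on0 hS hL) ur rP).
rewrite -[phi in LHS]/(id \o phi) (integral_lc_comp lcp _ ur)//.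
have {}rS t : t \in r -> S t.
  by move=> /rS[->|[g <-]]; [exact: subspace0|].
rewrite big_seq [RHS]big_seq.
have : S (\sum_(i <- r | i \in r) (fine (mu (phi @^-1` [set i])))%:C *: i) /\
  L (\sum_(i <- r | i \in r) (fine (mu (phi @^-1` [set i])))%:C *: i) =
    \sum_(i <- r | i \in r) (fine (mu (phi @^-1` [set i])))%:C *: L i.
  apply: (big_rec2 (fun x y => S x /\ L x = y)).
    by split; [exact: subspace0|exact: lin_on0 hL].
  move=> t x y tr [Sx <-]; split; last by rewrite hL//; apply: rS.
  by case: hS => _; apply => //; apply: rS.
by case.
Qed.

Lemma integral_lcD (M : lmodType R[i]) a (phi psi : G -> M) :
  lc_compact 0 phi -> lc_compact 0 psi ->
  integral_lc mu (fun g => a *: phi g + psi g) =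
  a *: integral_lc mu phi + integral_lc mu psi.
Proof.
move=> lcp lcs; have lc := lc_compact_pair lcp lcs.
have [r [ur rP rS]] := lc_compact_finite lc.
rewrite -[X in integral_lc mu X]/((fun t : M * M => a *: t.1 + t.2) \o (fun g => (phi g, psi g))).
rewrite (integral_lc_comp lc _ ur)//; last by rewrite /= scaler0 addr0.
rewrite -[X in a *: integral_lc mu X]/((fun t : M * M => t.1) \o (fun g => (phi g, psi g))).
rewrite -[X in _ + integral_lc mu X]/((fun t : M * M => t.2) \o (fun g => (phi g, psi g))).
rewrite !(integral_lc_comp lc _ ur)// scaler_sumr -big_split.
by apply: eq_bigr => t _; rewrite /= scalerDr !scalerA mulrC.
Qed.

Lemma integral_lc_translate (M : lmodType R[i]) (phi : G -> M) (k : G) :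
  locally_constant phi ->
  integral_lc mu (fun g => phi (k * g)%g) = integral_lc mu phi.
Proof.
move=> lcp; rewrite /integral_lc; apply: eq_fsbigr => w _; congr ((fine _)%:C *: _).
rewrite -(haar_left_invariant hmu (k^-1)%g (A := phi @^-1` [set w])); last first.
  by apply: open_measurable_borel; apply: lc_open.
congr (mu _); apply/seteqP; split => [g /= gw|_ [g /= gw <-]].
  by exists (k * g)%g => //; rewrite mulgA mulVg mul1g.
by rewrite mulgA mulgV mul1g.
Qed.

End Integral.

(** [ptopGroupType] does not relate the product to the topology. This is the compatibility used
    below; it is established for [kpoints] from the ultrametric norm. *)
Definition translation_continuous (G : ptopGroupType) := forall (h : G) (A : set G),
  open A -> open [set g | A (h * g)%g] /\ open [set g | A (g * h)%g].

(** Covers at once the representation on the whole of [V] and the translation of chains, whose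
    carrier is a proper subset of a function space. *)
Record smooth_action (R : realType) (G : ptopGroupType) (M : lmodType R[i])
    (S : set M) (act : G -> M -> M) : Prop := {
  act_subspace : is_subspace S;
  act_lin : forall g, lin_on S (act g);
  act_in : forall g x, S x -> S (act g x);
  actM : forall g h x, S x -> act (g * h)%g x = act g (act h x);
  act_smooth : forall x, S x -> nbhs (1%g : G) [set u | act u x = x] }.

Section SmoothActions.
Variables (R : realType) (G : ptopGroupType).
Hypothesis Gcont : translation_continuous G.

Lemma nbhs_mull (h g : G) (A : set G) :
  nbhs (h * g)%g A -> nbhs g [set x | A (h * x)%g].
Proof.
rewrite !nbhsE => -[B [oB Bg] BA]; exists [set x | B (h * x)%g].
  by split => //; case: (Gcont h oB).
by move=> x /BA.
Qed.

Lemma nbhs_mulr (h g : G) (A : set G) :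
  nbhs (g * h)%g A -> nbhs g [set x | A (x * h)%g].
Proof.
rewrite !nbhsE => -[B [oB Bg] BA]; exists [set x | B (x * h)%g].
  by split => //; case: (Gcont h oB).
by move=> x /BA.
Qed.

(* The support is covered by finitely many cosets [H g], with H an open subgroup
   such that [f] is constant on [H g]. *)
Lemma test_function_left_invariant (f : G -> R[i]) :
  is_test_function f ->
  (forall N, nbhs (1%g : G) N -> exists2 H : set G, is_subgroup H /\ open H & H `<=` N) ->
  exists2 N : set G, nbhs (1%g : G) N & forall k g, N k -> f (k * g)%g = f g.
Proof.
move=> [lc [A cA A0]] small.
have /choice[H hH] g : exists H : set G, [/\ is_subgroup H, open H &
    forall k, H k -> f (k * g)%g = f g].
  have [|H [sH oH] HN] := small [set k | f (k * g)%g = f g].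
    by apply: (@nbhs_mulr g 1%g [set k | f k = f g]); rewrite mul1g; exact: lc.
  by exists H.
have := cA; rewrite compact_cover => /(_ G setT (fun g => [set x | H g (x * g^-1)%g])).
case.
- by move=> g _; case: (hH g) => _ oH _; case: (Gcont (g^-1)%g oH).
- by move=> g Ag; exists g => //=; rewrite mulgV; have [[]] := hH g.
move=> D _ cov.
have fA k g : (forall d, d \in D -> H d k) -> A g -> f (k * g)%g = f g.
  move=> hk /cov[d dD /= gd]; have [[_ HM _] _ Hf] := hH d.
  rewrite -[g in LHS](mulgVK d) -[g in RHS](mulgVK d) mulgA !Hf//; apply: HM => //; exact: hk.
exists [set k | forall d, d \in D -> H d k /\ H d (k^-1)%g].
  have : nbhs (1%g : G) (\bigcap_(d in [set` D]) [set k | H d k /\ H d (k^-1)%g]).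
    apply: filter_bigI => d _; have [[H1 HM HV] oH _] := hH d.
    have : nbhs (1%g : G) (H d) by apply: open_nbhs_nbhs.
    by apply: filterS => k Hk; split => //; apply: HV.
  by apply: filterS => k hk d dD; apply: hk.
move=> k g hk; case: (pselect (A g)) => [|nAg].
  by apply: fA => d /hk[].
(* If [g] is outside [A] but [k * g] is in it, the invariance is applied at [k * g] with [k^-1];
   hence the condition on [k^-1] in the neighborhood. *)
case: (pselect (A (k * g)%g)) => [Akg|nAkg]; last by rewrite !A0.
rewrite -(fA (k^-1)%g _ _ Akg); first by rewrite mulgA mulVg mul1g.
by move=> d /hk[].
Qed.

Variables (M : lmodType R[i]) (S : set M) (act : G -> M -> M).
Hypothesis hact : smooth_action S act.
Variable mu : {measure set (borel G) -> \bar R}.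
Hypothesis hmu : is_haar mu.

Definition conv_op (f : G -> R[i]) (x : M) : M :=
  integral_lc mu (fun g => f g *: act g x).

Variable f : G -> R[i].
Hypothesis hf : is_test_function f.

(** For [h] near [g], the element [g^-1 h] fixes [x], so [act h x = act g x]. *)
Lemma conv_lc x : S x -> lc_compact 0 (fun g => f g *: act g x).
Proof.
move=> Sx; have [lc [A cA A0]] := hf.
split; last by exists A => // g /A0 ->; rewrite scale0r.
move=> g; have h1 : nbhs g [set h | act (g^-1 * h)%g x = x].
  apply: (@nbhs_mull (g^-1)%g g [set u | act u x = x]); rewrite mulVg.
  exact: (act_smooth hact Sx).
apply: filterS2 (lc g) h1 => h /= -> hx.
by rewrite -{1}[h](mulVKg g) (actM hact)// hx.
Qed.

Lemma conv_in x : S x -> S (conv_op f x).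
Proof.
move=> Sx; apply: (integral_lc_in hmu (act_subspace hact) (conv_lc Sx)) => g.
by apply: subspaceZ; [exact: act_subspace hact|exact: (act_in hact)].
Qed.

Lemma conv_lin : lin_on S (conv_op f).
Proof.
move=> a x y Sx Sy; rewrite /conv_op.
rewrite -(integral_lcD hmu _ (conv_lc Sx) (conv_lc Sy)).
congr (integral_lc _ _); apply/funext => g.
by rewrite (act_lin hact)// scalerDr !scalerA mulrC.
Qed.

Lemma conv_equivariant (N : lmodType R[i]) (act' : G -> N -> N) (L : M -> N) x :
  lin_on S L -> S x -> (forall g, L (act g x) = act' g (L x)) ->
  L (conv_op f x) = integral_lc mu (fun g => f g *: act' g (L x)).
Proof.
move=> hL Sx eqL; have hS := act_subspace hact.
rewrite (integral_lc_lin hmu hS hL (conv_lc Sx)); last first.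
  by move=> g; apply: subspaceZ; [exact: hS|exact: (act_in hact)].
congr (integral_lc _ _); apply/funext => g /=.
by rewrite (lin_onZ _ hS hL) ?eqL//; apply: (act_in hact).
Qed.

(** Applying [act k] under the integral gives the integrand [f g *: act (k * g) x], which equals
    [f (k * g) *: act (k * g) x]; left invariance of the measure removes [k]. *)
Lemma conv_fixed k x : S x -> (forall g, f (k * g)%g = f g) ->
  act k (conv_op f x) = conv_op f x.
Proof.
move=> Sx hk; have hS := act_subspace hact.
rewrite (integral_lc_lin hmu hS (act_lin hact k) (conv_lc Sx)); last first.
  by move=> g; apply: subspaceZ; [exact: hS|exact: (act_in hact)].
rewrite -[RHS](integral_lc_translate hmu k); last by case: (conv_lc Sx).
congr (integral_lc _ _); apply/funext => g /=.
rewrite (lin_onZ _ hS (act_lin hact k)) ?hk ?(actM hact)//.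
exact: (act_in hact).
Qed.

End SmoothActions.

(** * Continuity of translations on the rational points *)

Section CoordNorm.
Variables (R : realType) (p : nat) (F : fieldType) (absv : F -> R).
Hypothesis hF : is_Qp p absv.
Variable k : fieldExtType F.
Local Notation nrm := (@coord_norm R F absv k).

Lemma absv_sum_le (I : Type) (r : seq I) (f : I -> F) (B : R) : 0 <= B ->
  (forall i, absv (f i) <= B) -> absv (\sum_(i <- r) f i) <= B.
Proof.
move=> B0 fB; apply: (big_ind (fun x => absv x <= B)) => //.
  by rewrite (Qp_abs_eq0 hF 0).2.
move=> x y xB yB; apply: (le_trans (Qp_ultrametric hF _ _)).
by rewrite ge_max xB yB.
Qed.

Lemma coord_norm_ge0 x : 0 <= nrm x.
Proof. by apply: bigmax_ge_id. Qed.

Lemma coord_le_norm x i : absv (coord (vbasis {:k}) i x) <= nrm x.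
Proof. exact: (le_bigmax_cond _ (fun i => absv (coord (vbasis {:k}) i x))). Qed.

Lemma coord_norm_le x B : 0 <= B ->
  (forall i, absv (coord (vbasis {:k}) i x) <= B) -> nrm x <= B.
Proof. by move=> B0 h; apply: bigmax_le => // i _; apply: h. Qed.

Lemma coord_norm_sum_le (I : Type) (r : seq I) (f : I -> k) (B : R) : 0 <= B ->
  (forall i, nrm (f i) <= B) -> nrm (\sum_(i <- r) f i) <= B.
Proof.
move=> B0 fB; apply: coord_norm_le => // i; rewrite linear_sum.
by apply: absv_sum_le => // j; apply: le_trans (fB j); exact: coord_le_norm.
Qed.

(** Multiplication by [a] is linear over the base field; the sum of the absolute values of all its
    matrix entries is a crude but sufficient constant. *)
Lemma coord_norm_mul (a : k) : exists2 C, 0 <= C & forall x, nrm (a * x) <= C * nrm x.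
Proof.
pose c i j := absv (coord (vbasis {:k}) i (a * (vbasis {:k})`_j)).
have c0 i j : 0 <= c i j by apply: (Qp_abs_ge0 hF).
exists (\sum_i \sum_(j < \dim {:k}) c i j).
  by apply: sumr_ge0 => i _; apply: sumr_ge0.
have S0 : 0 <= \sum_i \sum_(j < \dim {:k}) c i j.
  by apply: sumr_ge0 => i _; apply: sumr_ge0.
move=> x; apply: coord_norm_le => [|i].
  by rewrite mulr_ge0// coord_norm_ge0.
rewrite {1}(coord_vbasis (memvf x)) mulr_sumr linear_sum.
apply: absv_sum_le => [|j]; first by rewrite mulr_ge0// coord_norm_ge0.
rewrite -scalerAr linearZ /= (Qp_absM hF) mulrC ler_pM ?(Qp_abs_ge0 hF)//.
  rewrite (bigD1 i)//= (bigD1 j)//= -addrA lerDl addr_ge0//.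
    by apply: sumr_ge0.
  by apply: sumr_ge0 => l _; apply: sumr_ge0.
exact: coord_le_norm.
Qed.

Lemma coord_norm_mulmx n (A : 'M[k]_n) : exists2 C, 0 < C &
  forall (B : 'M[k]_n) e, 0 <= e -> (forall i j, nrm (B i j) <= e) ->
    forall i j, nrm ((A *m B) i j) <= C * e /\ nrm ((B *m A) i j) <= C * e.
Proof.
have /choice[c hc] (ij : 'I_n * 'I_n) : exists C,
    0 <= C /\ forall x, nrm (A ij.1 ij.2 * x) <= C * nrm x.
  by have [C C0 hC] := coord_norm_mul (A ij.1 ij.2); exists C.
have hS ij : c ij <= 1 + \sum_l c l.
  rewrite (bigD1 ij)//= addrCA lerDl addr_ge0// sumr_ge0// => l _.
  by case: (hc l).
have S0 : 0 < 1 + \sum_l c l.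
  by rewrite ltr_pwDl// sumr_ge0// => l _; case: (hc l).
(* The sum of the [c l] dominates each of them, and the summand 1 makes the constant positive, so
   that it can be divided by. By the ultrametric inequality the sum in a matrix product costs no
   further factor. *)
exists (1 + \sum_l c l) => // B e e0 Be i j; split; rewrite mxE;
    apply: coord_norm_sum_le => [|l]; rewrite ?mulr_ge0// ?(ltW S0)//.
  apply: le_trans ((hc (i, l)).2 _) _; apply: ler_pM => //.
    by case: (hc (i, l)).
  exact: coord_norm_ge0.
rewrite mulrC; apply: le_trans ((hc (l, j)).2 _) _; apply: ler_pM => //.
  by case: (hc (l, j)).
exact: coord_norm_ge0.
Qed.

Lemma kpoints_translation_continuous (K : fieldType) (iota : {rmorphism k -> K})
    (n : nat) (GG : algebraicGroup iota n) :
  translation_continuous (kpoints absv GG).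
Proof.
move=> h A oA; have [C C0 hC] := coord_norm_mulmx (val h).
have oA' : kpoints_open A := oA.
(* The factor 2 turns the non-strict bound of [coord_norm_mulmx] into the strict one that open sets
   require. *)
have small eps (x y : kpoints absv GG) : 0 < eps ->
    (forall i j, coord_norm absv (val y i j - val x i j) < eps / (2 * C)) ->
    forall i j, coord_norm absv ((val h *m val y) i j - (val h *m val x) i j) < eps /\
      coord_norm absv ((val y *m val h) i j - (val x *m val h) i j) < eps.
  move=> eps0 hy i j; have e0 : 0 <= eps / (2 * C).
    by rewrite divr_ge0// ltW// mulr_gt0.
  have Be i' j' : nrm ((val y - val x) i' j') <= eps / (2 * C).
    by rewrite !mxE ltW.
  have mxB (A1 A2 : 'M[k]_n) : (A1 - A2) i j = A1 i j - A2 i j by rewrite !mxE.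
  have [] := hC _ _ e0 Be i j; rewrite mulmxBr mulmxBl !mxB => le1 le2.
  have lt2 : C * (eps / (2 * C)) < eps.
    rewrite mulrC -ltr_pdivlMr// ltr_pM2l// ltf_pV2 ?posrE ?mulr_gt0//.
    by rewrite ltr_pMl// ltr1n.
  by split; [exact: le_lt_trans le1 lt2 | exact: le_lt_trans le2 lt2].
split.
  suff : kpoints_open [set g : kpoints absv GG | A (h * g)%g] by [].
  move=> x /= /oA'[eps eps0 heps]; exists (eps / (2 * C)).
    by rewrite divr_gt0// mulr_gt0.
  by move=> y hy; apply: heps => i j; case: (small eps x y eps0 hy i j).
suff : kpoints_open [set g : kpoints absv GG | A (g * h)%g] by [].
move=> x /= /oA'[eps eps0 heps]; exists (eps / (2 * C)).
  by rewrite divr_gt0// mulr_gt0.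
by move=> y hy; apply: heps => i j; case: (small eps x y eps0 hy i j).
Qed.

End CoordNorm.

(** * Charts and orientations of facets *)

Section Polysimplex.
Variable R : realType.

Lemma sum_sqr_le (I : Type) (r : seq I) (a : I -> R) :
  \sum_(i <- r) a i ^+ 2 <= (\sum_(i <- r) `|a i|) ^+ 2.
Proof.
elim: r => [|i r IH]; first by rewrite !big_nil expr0n.
rewrite !big_cons sqrrD -real_normK ?num_real// -addrA lerD2l.
apply: le_trans IH _; rewrite lerDr mulrn_wge0// mulr_ge0// sumr_ge0//.
Qed.

(** The l^1 norm of the i-th vertex: the Lipschitz constant of [realize] in the i-th barycentric
    coordinate. *)
Definition realize_bound (N q : nat) (v : 'I_N -> 'rV[R]_q) i := \sum_j `|v i 0 j|.

Lemma realize_bound_ge0 (N q : nat) (v : 'I_N -> 'rV[R]_q) i : 0 <= realize_bound v i.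
Proof. exact: sumr_ge0. Qed.

Lemma realize_lipschitz (N q : nat) (v : 'I_N -> 'rV[R]_q) (l l' : 'I_N -> R) :
  euclidean_dist (realize v l) (realize v l') <=
  \sum_i `|l i - l' i| * realize_bound v i.
Proof.
have -> : euclidean_dist (realize v l) (realize v l') =
    Num.sqrt (\sum_j (\sum_i (l i - l' i) * v i 0 j) ^+ 2).
  congr Num.sqrt; apply: eq_bigr => j _; congr (_ ^+ 2).
  rewrite !summxE -sumrB; apply: eq_bigr => i _.
  by rewrite !mxE mulrBl.
apply: (le_trans (ler_wsqrtr (sum_sqr_le _ _))).
rewrite sqrtr_sqr ger0_norm ?sumr_ge0//.
apply: (@le_trans _ _ (\sum_j \sum_i `|l i - l' i| * `|v i 0 j|)).
  apply: ler_sum => j _; apply: le_trans (ler_norm_sum _ _ _) _.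
  by apply: ler_sum => i _; rewrite normrM.
rewrite exchange_big; apply: ler_sum => i _.
by rewrite -mulr_sumr.
Qed.

Lemma polysimplex_le1 N m (beta : 'I_N -> 'I_m) (l : 'I_N -> R) i :
  polysimplex beta l -> 0 <= l i <= 1.
Proof.
move=> [l0 l1]; rewrite l0 -(l1 (beta i)) (bigD1 i)//= lerDl sumr_ge0//.
Qed.

Lemma compact_polysimplex N m (beta : 'I_N -> 'I_m) :
  compact [set u : 'rV[R]_N | polysimplex beta (fun i => u 0 i)].
Proof.
have -> : [set u : 'rV[R]_N | polysimplex beta (fun i => u 0 i)] =
    [set u : 'rV[R]_N | forall i, `[0, 1]%classic (u 0 i)] `&`
    \bigcap_(j in [set: 'I_m])
      ((fun u : 'rV[R]_N => \sum_(i | beta i == j) u 0 i) @^-1` [set 1]).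
  apply/seteqP; split => u /=.
    move=> pu; split => [i|j _].
      by rewrite in_itv /=; exact: (polysimplex_le1 i pu).
    by case: pu => _; apply.
  move=> [u01 u1]; split=> [i|j]; last by have := u1 j I.
  by have := u01 i; rewrite in_itv => /andP[].
apply: compact_closedI.
  have := @rV_compact R N (fun=> `[0, 1]%classic) (fun=> @segment_compact R 0 1); exact.
apply: closed_bigI => j _.
have cont : continuous (fun u : 'rV[R]_N => \sum_(i | beta i == j) u 0 i).
  elim: (index_enum _) => [|i r IH].
    by under eq_fun do rewrite big_nil; exact: cst_continuous.
  under eq_fun do rewrite big_cons; case: (beta i == j) => //=.
  move=> u; have := continuousD (@coord_continuous R 1 N 0 i u) (IH u); exact.
apply: (preimage_closed (fun u _ => cont u)).
exact: accessible_closed_set1 (hausdorff_accessible (@norm_hausdorff R R)) 1.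
Qed.

End Polysimplex.

Section Charts.
Variables (R : realType) (X : metricType R) (facet : set (set X)).

Lemma euclidean_distK q (x y : 'rV[R]_q) :
  euclidean_dist x y ^+ 2 = \sum_i (x 0 i - y 0 i) ^+ 2.
Proof. by rewrite sqr_sqrtr// sumr_ge0// => i _; exact: sqr_ge0. Qed.

Lemma euclidean_dist_eq0 q (x y : 'rV[R]_q) : euclidean_dist x y = 0 -> x = y.
Proof.
move=> d0; have := euclidean_distK x y; rewrite d0 expr0n /= => /esym/eqP.
rewrite psumr_eq0 => [|i _]; last exact: sqr_ge0.
move=> /allP h; apply/rowP => i; apply/eqP; rewrite -subr_eq0 -sqrf_eq0.
exact: (h i (mem_index_enum _)).
Qed.

(** A nonempty facet provides a point [l0] with all barycentric coordinates positive. Any point of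
    [P] moved slightly towards it lands in the open cell. *)
Lemma chart_dense A q (P : set 'rV[R]_q) chi : is_chart facet A P chi -> A !=set0 ->
  forall x eps, P x -> 0 < eps ->
  exists y, [/\ P y, A (chi y) & mdist (chi x) (chi y) < eps].
Proof.
move=> [m [beta [v [_ -> isom -> _]]]] [_ [_ [l0 [pl0 pos] _] _]] _ eps [l pl <-] eps0.
pose B := \sum_i `|l i - l0 i| * realize_bound v i.
have B0 : 0 <= B by apply: sumr_ge0 => i _; rewrite mulr_ge0// realize_bound_ge0.
(* Moving by the fraction [s] towards [l0] displaces the point by at most [s * B]. This value gives
   [s <= 1] and [s * B < eps], also when [B = 0]. *)
pose s := eps / (B + eps) / 2.
have Be : 0 < B + eps by rewrite ltr_wpDl.
have s0 : 0 < s by rewrite !divr_gt0.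
have s1 : s <= 1.
  rewrite /s ler_pdivrMr// mul1r ler_pdivrMr//; nra.
pose ls i := (1 - s) * l i + s * l0 i.
have pls : polysimplex beta ls.
  case: pl => l_ge0 lsum; case: pl0 => l0_ge0 l0sum; split=> [i|j].
    by rewrite addr_ge0// mulr_ge0// ?subr_ge0// ltW.
  by rewrite big_split /= -!mulr_sumr lsum l0sum !mulr1 subrK.
exists (realize v ls); split; first by exists ls.
  exists (realize v ls) => //; exists ls => //; split => // i.
  rewrite finset.inE gt_eqF// ltr_wpDl//.
    by rewrite mulr_ge0// ?subr_ge0//; case: pl.
  rewrite mulr_gt0// lt_neqAle eq_sym pos finset.inE /=.
  by case: pl0.
rewrite isom; [|by exists l|by exists ls].
apply: le_lt_trans (realize_lipschitz _ _ _) _.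
have -> : \sum_i `|l i - ls i| * realize_bound v i = s * B.
  rewrite mulr_sumr; apply: eq_bigr => i _; rewrite mulrA; congr (_ * _).
  rewrite -[s in RHS]gtr0_norm// -normrM; congr `|_|; rewrite /ls; ring.
have sE : s * (B + eps) = eps / 2 by rewrite /s mulrAC divfK ?gt_eqF.
by have := mulr_gt0 s0 eps0; move: sE; rewrite mulrDr; lra.
Qed.

(** The image of [P] is the image of a compact polysimplex under a map that is Lipschitz on it, so
    it is compact, hence closed. *)
Lemma chart_closed A q (P : set 'rV[R]_q) chi z : is_chart facet A P chi ->
  (forall eps, 0 < eps -> exists2 y, P y & mdist z (chi y) < eps) ->
  exists2 y, P y & chi y = z.
Proof.
move=> [m [beta [v [_ -> isom _ _]]]] near_z.
pose S := [set u : 'rV[R]_(q + m) | polysimplex beta (fun i => u 0 i)].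
pose g (u : 'rV[R]_(q + m)) := chi (realize v (fun i => u 0 i)).
have gS u u' : S u -> S u' ->
    mdist (g u) (g u') <= \sum_i `|u 0 i - u' 0 i| * realize_bound v i.
  move=> Su Su'; rewrite isom; first exact: realize_lipschitz.
    by exists (fun i => u 0 i).
  by exists (fun i => u' 0 i).
have cg : {within S, continuous g}.
  apply/subspace_continuousP => u Su; apply/cvg_ballP => eps eps0.
  rewrite near_withinE.
  pose B := \sum_i realize_bound v i.
  have B0 : 0 <= B by apply: sumr_ge0 => i _; exact: realize_bound_ge0.
  have Be : 0 < eps / (B + 1) by rewrite divr_gt0// ltr_wpDl.
  have := nbhsx_ballx u _ Be; apply: filterS => u' buu' Su'; rewrite ballEmdist /=.
  apply: le_lt_trans (gS _ _ Su Su') _.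
  apply: (@le_lt_trans _ _ (\sum_i (eps / (B + 1)) * realize_bound v i)).
    apply: ler_sum => i _; apply: ler_wpM2r; first exact: realize_bound_ge0.
    by case: buu' => _ /(_ 0 i)/ltW.
  rewrite -mulr_sumr -/B mulrAC ltr_pdivrMr ?ltr_wpDl//; nra.
have /compact_closed : compact (g @` S).
  by apply: continuous_compact => //; exact: compact_polysimplex.
move=> /(_ (@metric_hausdorff _ _)) clo.
have : closure (g @` S) z.
  move=> N /nbhs_ballP[eps /= eps0 hN].
  have [_ [l pl <-] dl] := near_z _ eps0.
  exists (chi (realize v l)); split; last by apply: hN; rewrite ballEmdist.
  have le : (fun i => (\row_i l i : 'rV[R]_(q + m)) 0 i) = l.
    by apply/funext => i; rewrite mxE.
  by exists (\row_i l i); rewrite /S /g /= le.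
move=> /clo[u Su <-]; exists (realize v (fun i => u 0 i)) => //.
Qed.

Lemma chart_sub A q (P : set 'rV[R]_q) chi x : is_chart facet A P chi ->
  A x -> exists2 y, P y & chi y = x.
Proof.
move=> [m [beta [v [_ -> _ -> _]]]] [_ [l [pl _] <-] <-].
by exists (realize v l) => //; exists l.
Qed.

Lemma chart_bounded A q (P : set 'rV[R]_q) chi : is_chart facet A P chi ->
  exists B, forall x y, A x -> A y -> mdist x y <= B.
Proof.
move=> [m [beta [v [_ -> isom -> _]]]]; exists (\sum_i realize_bound v i).
move=> _ _ [_ [l [pl _] <-] <-] [_ [l' [pl' _] <-] <-].
rewrite isom; [|by exists l|by exists l'].
apply: le_trans (realize_lipschitz _ _ _) _; apply: ler_sum => i _.
rewrite ler_piMl ?realize_bound_ge0// ler_norml.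
have /andP[] := polysimplex_le1 i pl; have /andP[] := polysimplex_le1 i pl'.
by move=> *; apply/andP; split; lra.
Qed.

Lemma chart_inj A q (P : set 'rV[R]_q) chi x y : is_chart facet A P chi ->
  P x -> P y -> chi x = chi y -> x = y.
Proof.
move=> [m [beta [v [_ -> isom _ _]]]] Px Py exy.
by apply: euclidean_dist_eq0; rewrite -isom// exy mdistxx.
Qed.

Lemma chart_isometry A q (P : set 'rV[R]_q) chi x y : is_chart facet A P chi ->
  P x -> P y -> mdist (chi x) (chi y) = euclidean_dist x y.
Proof. by move=> [m [beta [v [_ _ + _ _]]]]; exact. Qed.

(** The facet is dense in the image of the first chart and contained in the closed image of the
    second, so two charts of a facet cover the same points. *)
Lemma chart_transition A q (P P' : set 'rV[R]_q) chi chi' x : A !=set0 ->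
  is_chart facet A P chi -> is_chart facet A P' chi' -> P x ->
  exists2 y, P' y & chi' y = chi x.
Proof.
move=> A0 h h' Px; apply: (chart_closed h') => eps eps0.
have [y [Py Ay dxy]] := chart_dense h A0 Px eps0.
by have [y' Py' ey] := chart_sub h' Ay; exists y' => //; rewrite ey.
Qed.

Definition frame_mx q (u : 'I_q.+1 -> 'rV[R]_q) : 'M[R]_q :=
  \matrix_(i < q) (u (lift ord0 i) - u ord0).

(* By polarization, the scalar products between the edges of two frames depend on
   the distances between their vertices only. *)
Lemma frame_mx_gram q (u e u' e' : 'I_q.+1 -> 'rV[R]_q) :
  (forall i j, euclidean_dist (u i) (e j) = euclidean_dist (u' i) (e' j)) ->
  frame_mx u *m (frame_mx e)^T = frame_mx u' *m (frame_mx e')^T.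
Proof.
pose s (x y : 'rV[R]_q) := \sum_k (x 0 k - y 0 k) ^+ 2.
have gram (w z : 'I_q.+1 -> 'rV[R]_q) i j : (frame_mx w *m (frame_mx z)^T) i j =
    (s (w (lift ord0 i)) (z ord0) + s (w ord0) (z (lift ord0 j))
     - s (w (lift ord0 i)) (z (lift ord0 j)) - s (w ord0) (z ord0)) / 2.
  rewrite mxE /s -big_split /= -!sumrB mulr_suml; apply: eq_bigr => k _.
  by rewrite !mxE; field.
move=> h; apply/matrixP => i j; rewrite !gram /s.
by rewrite -!euclidean_distK !h.
Qed.

Definition negative_frames q (P : set 'rV[R]_q) (chi : 'rV[R]_q -> X) :
    set ('I_q.+1 -> X) :=
  [set t | exists u, [/\ forall i, P (u i), t = chi \o u & \det (frame_mx u) < 0]].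

Lemma mul_sign_pos (x y a b : R) : x * a = y * b -> 0 < a * b -> (0 < x) = (0 < y).
Proof.
move=> e ab; have a0 : a != 0 by apply: contraTneq ab => ->; rewrite mul0r ltxx.
have yab : y * (a * b) = x * a ^+ 2 by rewrite mulrCA -e; ring.
by rewrite -(pmulr_lgt0 y ab) yab pmulr_lgt0// lt_def sqrf_eq0 a0 sqr_ge0.
Qed.

Lemma mul_sign_neg (x y a b : R) : x * a = y * b -> a * b < 0 -> (0 < x) = (y < 0).
Proof.
move=> e ab; rewrite -oppr_gt0; apply: (@mul_sign_pos x _ a (- b)).
  by rewrite mulrNN.
by rewrite mulrN oppr_gt0.
Qed.

(** The transition [tau] from [P'] to [P] preserves distances, so by [frame_mx_gram] it preserves
    the product of the determinants of two frames. Against a fixed nondegenerate frame [e], it thus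
    keeps all signs or reverses all of them. *)
Lemma positive_frames_transition A q (P P' : set 'rV[R]_q) chi chi' : A !=set0 ->
  is_chart facet A P chi -> is_chart facet A P' chi' ->
  [\/ positive_frames P' chi' = set0,
      positive_frames P' chi' = positive_frames P chi
    | positive_frames P' chi' = negative_frames P chi].
Proof.
move=> A0 h h'.
have /choice[tau htau] x : exists y, P' x -> P y /\ chi y = chi' x.
  have [Px|nPx] := pselect (P' x); last by exists 0.
  by have [y] := chart_transition A0 h' h Px; exists y.
(* Without a nondegenerate frame in [P'] the set of positive frames is empty, which is the first
   alternative. *)
have [[e [Pe det_e]]|none] := pselect (exists e : 'I_q.+1 -> 'rV[R]_q,
    (forall i, P' (e i)) /\ \det (frame_mx e) != 0); last first.
  apply: Or31; apply/seteqP; split => // t [u [Pu _ det_u]]; apply: none.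
  by exists u; split => //; rewrite gt_eqF.
have tau_dist x y : P' x -> P' y -> euclidean_dist x y = euclidean_dist (tau x) (tau y).
  move=> Px Py; have [Ptx etx] := htau _ Px; have [Pty ety] := htau _ Py.
  by rewrite -(chart_isometry h')// -(chart_isometry h)// etx ety.
have det_tau u : (forall i, P' (u i)) ->
    \det (frame_mx u) * \det (frame_mx e) =
    \det (frame_mx (tau \o u)) * \det (frame_mx (tau \o e)).
  move=> Pu; rewrite -[\det (frame_mx e)]det_tr -[\det (frame_mx (tau \o e))]det_tr.
  by rewrite -!det_mulmx; congr (\det _); apply: frame_mx_gram => i j; apply: tau_dist.
have lift_frame u : (forall i, P (u i)) -> exists u',
    [/\ forall i, P' (u' i), chi \o u = chi' \o u' & u = tau \o u'].
  move=> Pu; have /choice[u' hu'] i : exists y, P' y /\ chi' y = chi (u i).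
    by have [y] := chart_transition A0 h h' (Pu i); exists y.
  exists u'; split; first by move=> i; case: (hu' i).
    by apply/funext => i /=; case: (hu' i).
  apply/funext => i /=; case: (hu' i) => Pu'i eu'i.
  have [Pt et] := htau _ Pu'i.
  by apply: (chart_inj h) => //; rewrite et eu'i.
have etau_chi u : (forall i, P' (u i)) -> chi' \o u = chi \o (tau \o u).
  by move=> Pu; apply/funext => i /=; have [_ ->] := htau _ (Pu i).
have Ptau u : (forall i, P' (u i)) -> forall i, P ((tau \o u) i).
  by move=> Pu i /=; have [] := htau _ (Pu i).
have det_e2 := det_tau e Pe.
set a := \det (frame_mx e) in det_e det_e2 det_tau.
set b := \det (frame_mx (tau \o e)) in det_e2 det_tau.
have [ab|ab] : 0 < a * b \/ a * b < 0.
  have : a * b != 0.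
    rewrite mulf_neq0//; apply: contraNneq det_e => b0.
    by move: det_e2; rewrite b0 mul0r => /eqP; rewrite mulf_eq0 orbb.
  by move=> /lt_total/orP[]; [right|left].
- apply: Or32; apply/seteqP; split => t.
    move=> [u [Pu -> du]]; exists (tau \o u); split; [exact: Ptau|exact: etau_chi|].
    by rewrite -(mul_sign_pos (det_tau u Pu) ab).
  move=> [u [/lift_frame[u' [Pu' eu u_tau]] -> du]]; exists u'; split => //.
  by rewrite -/(frame_mx _) (mul_sign_pos (det_tau u' Pu') ab) -u_tau.
- apply: Or33; apply/seteqP; split => t.
    move=> [u [Pu -> du]]; exists (tau \o u); split; [exact: Ptau|exact: etau_chi|].
    by rewrite -(mul_sign_neg (det_tau u Pu) ab).
  move=> [u [/lift_frame[u' [Pu' eu u_tau]] -> du]]; exists u'; split => //.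
  by rewrite -/(frame_mx _) (mul_sign_neg (det_tau u' Pu') ab) -u_tau.
Qed.

(** Any chart of [A] may define an orientation, but by comparison with a single chart at most three
    sets of frames occur. Together with the finiteness of X^r, this bounds the rank of the
    truncations. *)
Lemma finite_orientations A q : A !=set0 ->
  finite_set [set c : set ('I_q.+1 -> X) | oriented_facet facet (A, c)].
Proof.
move=> A0; have [[P [chi h]]|none] := pselect (exists P chi, @is_chart R X facet A q P chi).
  apply: (@sub_finite_set _ _
    [set set0; positive_frames P chi; negative_frames P chi]).
    move=> c [_ [P' [chi' [/= h' ->]]]].
    by have [->|->|->] := positive_frames_transition A0 h h'; [left; left|left; right|right].
  by rewrite finite_setU; split; [apply: finite_set2|apply: finite_set1].
apply: (@sub_finite_set _ _ set0) => // c [_ [P [chi [/= h _]]]].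
by apply: none; exists P, chi.
Qed.

End Charts.

(** * Chains *)

Section FiniteSupport.
Variables (T : choiceType) (C : fieldType) (N : lmodType C).
Implicit Types (D S : set T) (x y : T -> N).

Lemma fsum_finite D S x : finite_set S -> (forall t, x t <> 0 -> S t) ->
  \sum_(t \in D) x t = \sum_(t <- fset_set (D `&` S)) x t.
Proof.
move=> fS xS; rewrite -fsbig_finite; last exact: finite_setIr.
apply/esym; apply: fsbig_widen; first exact: subIsetl.
by move=> t [Dt nDS]; apply: contrapT => /xS St; apply: nDS.
Qed.

Lemma finite_supportD a x y : finite_set [set t | x t <> 0] ->
  finite_set [set t | y t <> 0] -> finite_set [set t | a *: x t + y t <> 0].
Proof.
move=> fx fy; apply: (@sub_finite_set _ _ ([set t | x t <> 0] `|` [set t | y t <> 0])).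
  move=> t /= h; apply: contrapT => /not_orP[/contrapT x0 /contrapT y0].
  by apply: h; rewrite x0 y0 scaler0 addr0.
by rewrite finite_setU.
Qed.

Lemma fsum_lin D a x y : finite_set [set t | x t <> 0] ->
  finite_set [set t | y t <> 0] ->
  \sum_(t \in D) (a *: x t + y t) = a *: (\sum_(t \in D) x t) + \sum_(t \in D) y t.
Proof.
move=> fx fy.
pose S := [set t | x t <> 0] `|` [set t | y t <> 0].
have fS : finite_set S by rewrite finite_setU.
have xS t : x t <> 0 -> S t by left.
have yS t : y t <> 0 -> S t by right.
have xyS t : a *: x t + y t <> 0 -> S t.
  move=> h; apply: contrapT => /not_orP[/contrapT x0 /contrapT y0].
  by apply: h; rewrite x0 y0 scaler0 addr0.
rewrite (fsum_finite D fS xS) (fsum_finite D fS yS) (fsum_finite D fS xyS).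
by rewrite scaler_sumr -big_split.
Qed.

End FiniteSupport.

Lemma fsum_morph (T : choiceType) (C : fieldType) (N N' : lmodType C)
    (L : {linear N -> N'}) (D : set T) (x : T -> N) :
  finite_set [set t | x t <> 0] ->
  L (\sum_(t \in D) x t) = \sum_(t \in D) L (x t).
Proof.
move=> fx; rewrite (fsum_finite D fx)// (fsum_finite D fx).
  by rewrite linear_sum.
by move=> t Lx x0; apply: Lx; rewrite x0 linear0.
Qed.

Lemma funDZ (T : Type) (C : fieldType) (V : lmodType C) a (x y : T -> V) t :
  (a *: x + y) t = a *: x t + y t.
Proof. by []. Qed.

Section Chains.
Variables (R : realType) (G : ptopGroupType) (d : nat) (X : building R G d).
Variable U : schneider_stuhler_groups X.
Variables (V : lmodType R[i]) (pi : representation G V) (e : nat).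
Local Notation facet := (@bt_facet _ _ _ X).
Local Notation act := (@bt_act _ _ _ X).
Local Notation opair q := (set X * set ('I_q.+1 -> X))%type.

Lemma actK g : cancel (act g) (act g^-1%g).
Proof. by move=> x; rewrite -bt_actM mulVg bt_act1. Qed.

Lemma actVK g : cancel (act g^-1%g) (act g).
Proof. by move=> x; rewrite -bt_actM mulgV bt_act1. Qed.

(** The action on oriented facets; [translate] by [g] evaluates a chain at the shift by [g^-1]. *)
Definition shift q (g : G) (Fc : opair q) : opair q :=
  (act g @` Fc.1, [set act g \o t | t in Fc.2]).

Lemma shift1 q (Fc : opair q) : shift 1%g Fc = Fc.
Proof.
case: Fc => F c; rewrite /shift /=; congr pair; apply/seteqP; split.
- by move=> _ [x Fx <-]; rewrite bt_act1.
- by move=> x Fx; exists x => //; rewrite bt_act1.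
- by move=> _ [t ct <-]; rewrite (_ : _ \o t = t)//; apply/funext => i /=; rewrite bt_act1.
- by move=> t ct; exists t => //; apply/funext => i /=; rewrite bt_act1.
Qed.

Lemma shiftM q g h (Fc : opair q) : shift (g * h)%g Fc = shift g (shift h Fc).
Proof.
case: Fc => F c; rewrite /shift /= !image_comp; congr pair.
  by apply: eq_imagel => x _; rewrite /= bt_actM.
by apply: eq_imagel => t _ /=; apply/funext => i /=; rewrite bt_actM.
Qed.

Lemma shiftK q g : cancel (@shift q g) (shift g^-1%g).
Proof. by move=> Fc; rewrite -shiftM mulVg shift1. Qed.

Lemma shiftVK q g : cancel (@shift q g^-1%g) (shift g).
Proof. by move=> Fc; rewrite -shiftM mulgV shift1. Qed.

Lemma chart_shift A q (P : set 'rV[R]_q) chi g : is_chart facet A P chi ->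
  is_chart facet (act g @` A) P (act g \o chi).
Proof.
move=> [m [beta [v [inj PE isom AE fac]]]]; exists m, beta, v; split => //.
- by move=> x y Px Py; rewrite /= bt_act_isometric isom.
- by rewrite AE image_comp.
- by move=> J /fac hJ; rewrite -image_comp; apply: bt_act_facet.
Qed.

Lemma oriented_shift q g (Fc : opair q) :
  oriented_facet facet Fc -> oriented_facet facet (shift g Fc).
Proof.
move=> [hF [P [chi [hchi hc]]]]; split; first exact: bt_act_facet.
exists P, (act g \o chi); split; first exact: chart_shift.
rewrite /= hc; apply/seteqP; split.
  by move=> _ [_ [u [Pu -> du]] <-]; exists u.
by move=> _ [u [Pu -> du]]; exists (chi \o u) => //; exists u.
Qed.

Lemma oriented_shiftE q g (Fc : opair q) :
  oriented_facet facet (shift g Fc) <-> oriented_facet facet Fc.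
Proof.
split; last exact: oriented_shift.
by move/(oriented_shift g^-1%g); rewrite shiftK.
Qed.

Lemma building_facet_nonempty F : facet F -> F !=set0.
Proof. exact: facet_nonempty (bt_complex X) F. Qed.

(** [ss_fixes] concerns the open facet, whereas orientations involve points of its closure. As [u]
    acts isometrically, [chart_dense] extends the fixed points to the closure. *)
Lemma shift_fixed q u (Fc : opair q) : oriented_facet facet Fc ->
  U Fc.1 e u -> shift u Fc = Fc.
Proof.
case: Fc => F c [/= hF [P [chi [hchi hc]]]] hu.
have fixF x : F x -> act u x = x by exact: ss_fixes hu.
have fixP x : P x -> act u (chi x) = chi x.
  move=> Px; apply: mdist_positivity; apply/eqP; rewrite eq_le mdist_ge0 andbT.
  apply/ler_addgt0Pr => eps eps0; rewrite add0r.
  have eps2 : 0 < eps / 2 by rewrite divr_gt0.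
  have [y [Py Fy dxy]] := chart_dense hchi (building_facet_nonempty hF) Px eps2.
  apply: le_trans (metric_triangle _ (chi y) _) _.
  rewrite -{1}(fixF _ Fy) bt_act_isometric [mdist (chi y) _]metric_sym; lra.
rewrite /shift /=; congr pair; apply/seteqP; split.
- by move=> _ [x Fx <-]; rewrite fixF.
- by move=> x Fx; exists x => //; rewrite fixF.
- rewrite hc => _ [_ [v [Pv -> dv]] <-].
  by exists v; split => //; apply/funext => i /=; rewrite fixP.
- rewrite hc => t [v [Pv -> dv]]; exists (chi \o v); first by exists v.
  by apply/funext => i /=; rewrite fixP.
Qed.

Lemma opp_shift q g (c : set ('I_q.+1 -> X)) :
  opp_orientation [set act g \o t | t in c] = [set act g \o t | t in opp_orientation c].
Proof.
apply/seteqP; split => t.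
  move=> [s cs est]; exists (act g^-1%g \o t).
    rewrite /opp_orientation /= (_ : _ \o _ = s)//.
    by apply/funext => i /=; rewrite -[t _]/((t \o _) i) -est /= actK.
  by apply/funext => i /=; rewrite actVK.
by move=> [s cs <-]; exists (s \o tperm ord0 (inord 1)).
Qed.

Lemma subspace_chains q : is_subspace (chains U pi e q).
Proof.
split.
  split => //.
  - by rewrite (_ : [set _ | _] = set0)//; apply/seteqP; split => // t /=.
  - by move=> Fc _ g _; rewrite linear0.
  - by move=> _ Fc _; rewrite oppr0.
move=> a x y [x1 x2 x3 x4] [y1 y2 y3 y4]; split.
- by move=> Fc h; change (a *: x Fc + y Fc = 0); rewrite (x1 _ h) (y1 _ h) scaler0 addr0.
- exact: finite_supportD.
- by move=> Fc h g hg; rewrite funDZ linearP x3// y3.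
- by move=> q0 Fc h; change (a *: x (Fc.1, opp_orientation Fc.2) + y (Fc.1, opp_orientation Fc.2)
    = - (a *: x Fc + y Fc)); rewrite x4// y4// scalerN opprD.
Qed.

Lemma translateE q g (w : chain_map X V q) Fc :
  translate pi g w Fc = pi g (w (shift g^-1%g Fc)).
Proof. by []. Qed.

Lemma translate_lin q g : lin_on (chains U pi e q) (@translate R G d X V pi q g).
Proof.
move=> a x y _ _; apply/funext => Fc.
by rewrite funDZ !translateE funDZ linearP.
Qed.

Lemma repKV g v : pi g^-1%g (pi g v) = v.
Proof. by rewrite -repM mulVg rep1. Qed.

Lemma translate_chains q g w : chains U pi e q w -> chains U pi e q (translate pi g w).
Proof.
move=> [w1 w2 w3 w4]; split.
- by move=> Fc h; rewrite translateE w1 ?linear0// oriented_shiftE.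
- apply: (@sub_finite_set _ _ (shift g @` [set Fc | w Fc <> 0])); last exact: finite_image.
  move=> Fc /= h; exists (shift g^-1%g Fc); last by rewrite shiftVK.
  by move=> /= h0; apply: h; rewrite translateE h0 linear0.
- move=> Fc h k hk; rewrite translateE.
  have h' : oriented_facet facet (shift g^-1%g Fc) by apply/oriented_shiftE.
  have [u hu <-] : [set (g * u * g^-1)%g | u in U (shift g^-1%g Fc).1 e] k.
    rewrite ss_conj; last by case: h'.
    by rewrite /shift /= image_comp (_ : _ \o _ = id) ?image_id//; apply/funext => x /=; rewrite actVK.
  by rewrite !repM repKV w3.
- move=> q0 Fc h; rewrite !translateE -linearN; congr (pi g _).
  rewrite -w4//; last by apply/oriented_shiftE.
  by rewrite /shift /= opp_shift.
Qed.

Lemma translateM q g h (w : chain_map X V q) :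
  translate pi (g * h)%g w = translate pi g (translate pi h w).
Proof. by apply/funext => Fc; rewrite !translateE repM invgM shiftM. Qed.

(** The finite intersection of the groups of the facets in the support is a neighborhood of 1; its
    elements fix these oriented facets and the values of [w] there. *)
Lemma chains_smooth q (w : chain_map X V q) : chains U pi e q w ->
  nbhs (1%g : G) [set u | translate pi u w = w].
Proof.
move=> [w1 w2 w3 w4].
have : nbhs (1%g : G) (\bigcap_(Fc in [set Fc | w Fc <> 0]) U Fc.1 e).
  have -> : [set Fc | w Fc <> 0] = [set` fset_set [set Fc | w Fc <> 0]].
    by rewrite fset_setK.
  apply: filter_bigI => Fc; rewrite in_fset_set// => /set_mem /= wFc.
  have hFc : facet Fc.1 by apply: contrapT => nF; apply: wFc; apply: w1 => -[].
  by apply: open_nbhs_nbhs; split; [exact: ss_open|case: (ss_subgroup U e hFc)].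
apply: filterS => u hu /=; apply/funext => Fc; rewrite translateE.
have orF Fc' : w Fc' <> 0 -> oriented_facet facet Fc'.
  by move=> h; apply: contrapT => /w1.
have fix_supp Fc' : w Fc' <> 0 -> shift u Fc' = Fc'.
  by move=> h; apply: shift_fixed; [exact: orF|exact: hu].
(* If the shift of [Fc] by [u^-1] is outside the support, then so is [Fc], since [u] fixes every
   oriented facet of the support. *)
have [w0|wn0] := pselect (w (shift u^-1%g Fc) = 0).
  rewrite w0 linear0; have [->//|/eqP wFc] := eqVneq (w Fc) 0.
  by move: w0; rewrite -{1}(fix_supp _ wFc) shiftK.
rewrite -[Fc in RHS](shiftVK u) (fix_supp _ wn0).
by apply: w3; [exact: orF|exact: hu].
Qed.

Lemma smooth_chains q :
  smooth_action (chains U pi e q) (@translate R G d X V pi q).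
Proof.
split; [exact: subspace_chains|exact: translate_lin|exact: translate_chains
  |by move=> *; exact: translateM|exact: chains_smooth].
Qed.

Definition incident q (Fc' : opair q) : set (opair q.+1) :=
  [set Fc | [/\ oriented_facet facet Fc, Fc'.1 `<=` closure Fc.1 & induces Fc Fc']].

Lemma closure_shift g (A B : set X) : A `<=` closure B ->
  act g @` A `<=` closure (act g @` B).
Proof.
move=> AB _ [x /AB clx <-] N /nbhs_ballP[eps /= eps0 hN].
have [y [By bxy]] := clx _ (nbhsx_ballx x _ eps0).
exists (act g y); split; first by exists y.
by apply: hN; move: bxy; rewrite !ballEmdist /= bt_act_isometric.
Qed.

Lemma incident_shift q g (Fc' : opair q) Fc :
  incident Fc' Fc -> incident (shift g Fc') (shift g Fc).
Proof.
move=> [oFc sub ind]; split; first exact: oriented_shift.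
  exact: closure_shift.
move=> _ _ [x Fx <-] [t ct <-].
exists (fun i => if unlift ord0 i is Some j then t j else x); first exact: ind.
by apply/funext => i /=; case: unlift.
Qed.

Lemma shift_incident_bij q g (Fc' : opair q) :
  set_bij (incident Fc') (incident (shift g Fc')) (shift g).
Proof.
split; first by move=> Fc; exact: incident_shift.
- by move=> x y _ _; exact: (can_inj (shiftK g)).
- move=> Fc /(incident_shift g^-1%g); rewrite shiftK => h.
  by exists (shift g^-1%g Fc) => //; rewrite shiftVK.
Qed.

Lemma shift_oriented_bij q g : set_bij (@oriented_facet R X facet q)
  (@oriented_facet R X facet q) (shift g).
Proof.
split; first by move=> Fc; exact: oriented_shift.
- by move=> x y _ _; exact: (can_inj (shiftK g)).
- move=> Fc /(oriented_shift g^-1%g) h.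
  by exists (shift g^-1%g Fc) => //; rewrite shiftVK.
Qed.

Lemma boundaryE q (w : chain_map X V q.+1) Fc' : oriented_facet facet Fc' ->
  boundary w Fc' = \sum_(Fc \in incident Fc') w Fc.
Proof. by move=> h; rewrite /boundary asboolT. Qed.

Lemma boundaryN q (w : chain_map X V q.+1) Fc' : ~ oriented_facet facet Fc' ->
  boundary w Fc' = 0.
Proof. by move=> h; rewrite /boundary asboolF. Qed.

Lemma boundary_lin q : lin_on (chains U pi e q.+1) (@boundary _ _ _ X V q).
Proof.
move=> a x y [_ fx _ _] [_ fy _ _]; apply/funext => Fc'.
rewrite funDZ.
have [oF|noF] := pselect (oriented_facet facet Fc').
  by rewrite !boundaryE//; exact: fsum_lin.
by rewrite !boundaryN// scaler0 addr0.
Qed.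

Lemma augmentation_lin : lin_on (chains U pi e 0) (@augmentation _ _ _ X V).
Proof. by move=> a x y [_ fx _ _] [_ fy _ _]; exact: fsum_lin. Qed.

Lemma boundary_translate q g (w : chain_map X V q.+1) : chains U pi e q.+1 w ->
  boundary (translate pi g w) = translate pi g (boundary w).
Proof.
move=> [_ fw _ _]; apply/funext => Fc'; rewrite translateE.
have [oF|noF] := pselect (oriented_facet facet Fc'); last first.
  by rewrite !boundaryN ?linear0// oriented_shiftE.
have oFc' : oriented_facet facet (shift g^-1%g Fc') by apply/oriented_shiftE.
rewrite !boundaryE// fsum_morph//.
by rewrite (reindex_fsbig _ _ _ _ (shift_incident_bij g^-1%g Fc')).
Qed.

Lemma augmentation_translate g (w : chain_map X V 0) : chains U pi e 0 w ->
  augmentation (translate pi g w) = pi g (augmentation w).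
Proof.
move=> [_ fw _ _]; rewrite /augmentation fsum_morph//.
by rewrite [RHS](reindex_fsbig _ _ _ _ (shift_oriented_bij 0 g^-1%g)).
Qed.

Variable o : X.
Local Notation Xr := (Xr facet o).
Local Notation trunc r := (truncation o r).

Lemma truncation_chains q r (w : chain_map X V q) : chains U pi e q w ->
  chains U pi e q (trunc r w).
Proof.
move=> [w1 w2 w3 w4]; split; rewrite /truncation.
- by move=> Fc /w1 ->; case: ifP.
- by apply: sub_finite_set w2 => Fc /=; case: ifP.
- by move=> Fc oFc g hg; case: ifP => _; [exact: w3|rewrite linear0].
- by move=> q0 Fc oFc /=; case: ifP => _; [exact: w4|rewrite oppr0].
Qed.

Lemma truncation_lin q r (S : set (chain_map X V q)) : lin_on S (@truncation R G d X V o r q).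
Proof.
move=> a x y _ _; apply/funext => Fc.
rewrite funDZ /truncation funDZ.
by case: ifP => // _; rewrite scaler0 addr0.
Qed.

Lemma hull_stage_sub r n : hull_stage facet o r n `<=` hull_stage facet o r n.+1.
Proof. by move=> x hx /= Z _; apply => Y _; apply. Qed.

Lemma hull_stage_subn r n m : (n <= m)%N ->
  hull_stage facet o r n `<=` hull_stage facet o r m.
Proof.
move=> /subnK <-; elim: (m - n)%N => // k IH.
by apply: subset_trans IH _; exact: hull_stage_sub.
Qed.

(** Once two consecutive stages agree, all later ones do, so X^r is the stage known to contain
    finitely many facets. *)
Lemma finite_Xr r : 0 <= r -> finite_set [set A | facet A /\ A `<=` Xr r].
Proof.
move=> /(bt_stabilizes o)[n [stab fin]]; suff -> : Xr r = hull_stage facet o r n by [].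
have stabk k : hull_stage facet o r (k + n) = hull_stage facet o r n.
  by elim: k => // k IH; rewrite addSn /= IH.
apply/seteqP; split; last by move=> x hx; exists n.
move=> x [m _ hx]; rewrite -(stabk m).
by apply: hull_stage_subn hx; exact: leq_addr.
Qed.

Lemma finite_oriented_Xr q r : 0 <= r ->
  finite_set [set Fc : opair q | oriented_facet facet Fc /\ Fc.1 `<=` Xr r].
Proof.
move=> r0; apply: (@sub_finite_set _ _ (\bigcup_(A in [set A | facet A /\ A `<=` Xr r])
    (pair A @` [set c : set ('I_q.+1 -> X) | oriented_facet facet (A, c)]))).
  by move=> [A c] /= [oA AX]; exists A; [split => //; case: oA|exists c].
apply: bigcup_finite; first exact: finite_Xr.
move=> A [fA _]; apply: finite_image; apply: finite_orientations.
exact: building_facet_nonempty.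
Qed.

Lemma ball_sub_Xr r x : mdist o x <= r -> Xr r x.
Proof. by move=> h; exists 0%N. Qed.

(** The support consists of finitely many bounded facets, and X^r contains the ball of radius r. The
    radius is the sum of the bounds [|B Fc|] over the support, which dominates each of them. *)
Lemma truncation_id q (w : chain_map X V q) : chains U pi e q w ->
  exists2 r0, 0 <= r0 & forall r, r0 <= r -> trunc r w = w.
Proof.
move=> [w1 w2 w3 w4].
have /choice[B hB] Fc : exists B, w Fc <> 0 -> forall x, Fc.1 x -> mdist o x <= B.
  have [->|/eqP wFc] := eqVneq (w Fc) 0; first by exists 0.
  have [fF [P [chi [hchi _]]]] : oriented_facet facet Fc by apply: contrapT => /w1.
  have [B hB] := chart_bounded hchi.
  have [y Fy] := building_facet_nonempty fF; exists (mdist o y + B) => _ x Fx.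
  apply: le_trans (metric_triangle _ y _) _.
  by rewrite lerD2l; exact: hB.
exists (\sum_(Fc <- fset_set [set Fc | w Fc <> 0]) `|B Fc|).
  by apply: sumr_ge0.
move=> r r0r; apply/funext => Fc; rewrite /truncation.
case: ifPn => // /asboolPn nsub; apply/esym; apply: contrapT => wFc.
apply: nsub => x Fx; apply: ball_sub_Xr; apply: le_trans (hB _ wFc _ Fx) _.
apply: le_trans r0r; apply: le_trans (ler_norm _) _.
have Fcs : Fc \in fset_set [set Fc | w Fc <> 0] by rewrite in_fset_set//; exact/mem_set.
by rewrite (big_rem _ Fcs)/= lerDl sumr_ge0.
Qed.

Lemma findim_supported q (s : seq (opair q)) (W : opair q -> set V) :
  (forall Fc, Fc \in s -> findim (W Fc)) ->
  findim [set w : chain_map X V q | forall Fc, if Fc \in s then W Fc (w Fc) else w Fc = 0].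
Proof.
elim: s => [_|a s IH hW].
  exists 0%N, (fun=> 0) => w hw; exists (fun=> 0); rewrite big1.
    by apply/funext => Fc; exact: hw.
  by move=> i _; rewrite scale0r.
have fd1 := IH (fun Fc hFc => hW Fc (mem_behead (s := a :: s) hFc)).
pose dl (v : V) : chain_map X V q := fun Fc => if Fc == a then v else 0.
have [n [b hb]] := hW a (mem_head _ _).
have dl_lin : lin_on (lin_span b) dl.
  move=> c x y _ _; apply/funext => Fc.
  rewrite funDZ /dl; case: ifP => // _.
  by rewrite scaler0 addr0.
have fd2 : findim (dl @` lin_span b).
  by apply: findim_image; [exact: subspace_span|exact: dl_lin|exists n, b].
apply: findimS (findim_add fd2 fd1) => w hw.
(* The list may repeat [a]; in that case the value at [a] is already covered by the induction
   hypothesis and nothing is split off. *)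
have [as_|nas] := boolP (a \in s).
  exists (dl 0), w; split; first by exists 0 => //; apply: subspace0 (subspace_span b).
    move=> Fc; have := hw Fc; rewrite in_cons; have [->|_] := eqVneq Fc a => //=.
    by rewrite as_.
  apply/funext => Fc; change (w Fc = dl 0 Fc + w Fc); rewrite /dl.
  by case: ifP; rewrite add0r.
exists (dl (w a)), (fun Fc => if Fc == a then 0 else w Fc); split.
- by exists (w a) => //; apply: hb; have := hw a; rewrite mem_head.
- move=> Fc; have := hw Fc; rewrite in_cons; have [->|_] := eqVneq Fc a => //=.
  by rewrite (negbTE nas).
- apply/funext => Fc; change (w Fc = dl (w a) Fc + if Fc == a then 0 else w Fc); rewrite /dl.
  by have [->|_] := eqVneq Fc a; rewrite ?addr0 ?add0r.
Qed.

Hypothesis hadm : is_admissible pi.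

Lemma findim_fixed F : facet F -> findim (fixed_vectors pi (U F e)).
Proof.
move=> hF; case: hadm => _ /(_ (U F e)) h.
by have [n [b hb]] := h (ss_subgroup U e hF) (ss_open U e hF) (@ss_compact _ _ _ _ U F e hF); exists n, b.
Qed.

(** A truncated chain is given by finitely many values, each in the invariants of a compact open
    subgroup, and these are finite-dimensional by admissibility. *)
Lemma findim_truncation q r : 0 <= r ->
  findim ((@truncation R G d X V o r q) @` chains U pi e q).
Proof.
move=> r0; have fin := finite_oriented_Xr q r0.
set S := [set Fc | _] in fin.
apply: findimS (@findim_supported q (fset_set S)
  (fun Fc => fixed_vectors pi (U Fc.1 e)) _); last first.
  by move=> Fc; rewrite in_fset_set// => /set_mem[[hF _] _]; exact: findim_fixed.
move=> _ [w [w1 w2 w3 w4] <-] Fc; rewrite in_fset_set//.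
case: ifPn => [/set_mem|/negP] hS; rewrite /truncation.
  by case: hS => oFc sub; rewrite asboolT//; exact: w3.
by case: ifP => // /asboolP sub; apply: w1 => oFc; apply: hS; exact/mem_set.
Qed.

End Chains.

(** * Modified truncation *)

Section ModifiedTruncation.
Variables (R : realType) (G : ptopGroupType) (d : nat) (X : building R G d).
Variable U : schneider_stuhler_groups X.
Variables (V : lmodType R[i]) (pi : representation G V) (e : nat).
Variable mu : {measure set (borel G) -> \bar R}.
Variable f : G -> R[i].
Variables H' B' : forall q, set (chain_map X V q).
Hypothesis Gcont : translation_continuous G.
Hypothesis hadm : is_admissible pi.
Hypothesis hex : is_exact U pi e.
Hypothesis hmu : is_haar mu.
Hypothesis hf : is_test_function f.
Hypothesis hdec : is_decomposition U pi e H' B'.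
Variables (o : X) (r : R).
Hypothesis r0 : 0 <= r.

Local Notation Cq q := (chains U pi e q).
Local Notation Zq q := (cycles U pi e q).
Local Notation Bq q := (boundaries U pi e q).
Local Notation bd := (@boundary R G d X V _).
Local Notation trunc := (@truncation R G d X V o r _).
Local Notation pB := (@proj_B R G d X U V pi e H' B' _).
Local Notation pH := (@proj_H' R G d X U V pi e H' B' _).
Local Notation pB' := (@proj_B' R G d X U V pi e H' B' _).
Local Notation tilde := (@tilde_truncation R G d X U V pi e H' B' o r _).
Local Notation Qbar q := (modified_truncation U pi e H' B' o r q).
Local Notation Tf := (@chain_op R G d X V pi mu f _).

Lemma subspace_cycles q : is_subspace (Zq q).
Proof.
case: q => [|q]; first exact: subspace_chains.
by apply: subspace_ker; [exact: subspace_chains|exact: boundary_lin].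
Qed.

Lemma cycles_chains q : Zq q `<=` Cq q.
Proof. by case: q => [|q] //= w []. Qed.

Lemma subspace_boundaries q : is_subspace (Bq q).
Proof. by apply: subspace_image; [exact: subspace_chains|exact: boundary_lin]. Qed.

(** That the boundary squares to zero is read off exactness, which avoids any computation with
    orientations. *)
Lemma boundaries_cycles q : (q <= d)%N -> Bq q `<=` Zq q.
Proof.
case: hex => _ e0 eq; case: q => [_|q qd].
  by rewrite -e0 => w [].
by rewrite (eq q.+1).
Qed.

Lemma boundaries_chains q : (q <= d)%N -> Bq q `<=` Cq q.
Proof. by move=> qd; apply: subset_trans (boundaries_cycles qd) (@cycles_chains q). Qed.

Lemma decomposition_complement q : (q <= d)%N -> is_complement (@H' q) (Bq q) (Zq q).
Proof. by move=> /hdec[]. Qed.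

Lemma decomposition_complement' q : (q <= d)%N -> is_complement (@B' q) (Zq q) (Cq q).
Proof. by move=> /hdec[]. Qed.

Section Degree.
Variable q : nat.
Hypothesis qd : (q <= d)%N.
Let sZ := subspace_cycles q.
Let sB := subspace_boundaries q.
Let BZ := boundaries_cycles qd.
Let ZC := @cycles_chains q.
Let cH := decomposition_complement qd.
Let cB' := decomposition_complement' qd.

Lemma subspace_H' : is_subspace (@H' q). Proof. by case: cH. Qed.
Lemma subspace_B' : is_subspace (@B' q). Proof. by case: cB'. Qed.
Lemma H'_chains : @H' q `<=` Cq q.
Proof. by apply: subset_trans ZC; case: cH. Qed.
Lemma B'_chains : @B' q `<=` Cq q. Proof. by case: cB'. Qed.

Lemma endo_pB : endo_on (Cq q) pB.
Proof. exact: (endo_component1 sZ sB BZ ZC cH cB'). Qed.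
Lemma endo_pH : endo_on (Cq q) pH.
Proof. exact: (endo_component2 sZ sB BZ ZC cH cB'). Qed.
Lemma endo_pB' : endo_on (Cq q) pB'.
Proof. exact: (endo_component3 sZ sB BZ cH cB'). Qed.

Lemma proj_in w : Cq q w ->
  [/\ Bq q (pB w), @H' q (pH w), @B' q (pB' w) & w = pB w + pH w + pB' w].
Proof.
move=> /(componentsP cH cB')[x [y [z [Bx Hy Bz ->]]]].
by rewrite /proj_B /proj_H' /proj_B' (componentsE sZ sB BZ cH cB').
Qed.

Lemma projE x y z : Bq q x -> @H' q y -> @B' q z ->
  [/\ pB (x + y + z) = x, pH (x + y + z) = y & pB' (x + y + z) = z].
Proof.
by move=> *; rewrite /proj_B /proj_H' /proj_B' (componentsE sZ sB BZ cH cB').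
Qed.

Lemma proj_boundaries x : Bq q x -> [/\ pB x = x, pH x = 0 & pB' x = 0].
Proof.
move=> Bx; have := projE Bx (subspace0 subspace_H') (subspace0 subspace_B').
by rewrite !addr0.
Qed.

Lemma endo_trunc : endo_on (Cq q) trunc.
Proof. by split; [exact: truncation_lin|move=> w; exact: truncation_chains]. Qed.

Lemma endo_Tf : endo_on (Cq q) Tf.
Proof.
have hs := smooth_chains U pi e q.
split; [exact: (conv_lin Gcont hs hmu hf)|move=> w; exact: (conv_in Gcont hs hmu hf)].
Qed.

End Degree.

(** The choice in [tilde_truncation] is not vacuous: p_B produces a boundary of some chain [c], and
    dropping the cycle part of [c] leaves an element of B' with the same boundary. *)
Lemma tildeP q b : (q < d)%N -> @B' q.+1 b ->
  @B' q.+1 (tilde b) /\ bd (tilde b) = pB (trunc (bd b)).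
Proof.
move=> qd Bb; rewrite /tilde_truncation.
set P := [set _ | _]; suff : P (xget 0 P) by [].
apply: xgetPex.
have Cb := B'_chains qd Bb.
have Cbb : Cq q (bd b) by apply: (boundaries_chains (ltnW qd)); exists b.
have [[c Cc bc] _ _ _] := proj_in (ltnW qd) (truncation_chains o r Cbb).
have [_ _ _ /(_ c Cc)[z [b'' [[Cz bz] Bb'' ec]]]] := decomposition_complement' qd.
exists b''; split => //; rewrite -bc ec.
rewrite (lin_onD (@boundary_lin _ _ _ _ U _ pi e q))//; last exact: (B'_chains qd).
by rewrite bz add0r.
Qed.

Lemma boundary_inj_B' q b : (q < d)%N -> @B' q.+1 b -> bd b = 0 -> b = 0.
Proof.
move=> qd Bb b0; apply: (complement_inj (decomposition_complement' qd)) => //.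
by split => //; exact: (B'_chains qd).
Qed.

(** The operator is defined by choice; its linearity is checked after applying the boundary, which
    is injective on B'. *)
Lemma endo_tilde q : (q < d)%N -> endo_on (@B' q.+1) tilde.
Proof.
move=> qd; have lbd := @boundary_lin _ _ _ _ U _ pi e q.
have sB' := subspace_B' qd; have B'C := B'_chains qd.
have bdC w : @B' q.+1 w -> Cq q (bd w).
  by move=> /B'C Cw; apply: (boundaries_chains (ltnW qd)); exists w.
split; last by move=> x /(tildeP qd)[].
move=> a x y Bx By.
have Bxy : @B' q.+1 (a *: x + y) by case: sB' => _; apply.
have [Tx tx] := tildeP qd Bx; have [Ty ty] := tildeP qd By.
have [Txy txy] := tildeP qd Bxy.
have Txy' : @B' q.+1 (a *: tilde x + tilde y) by case: sB' => _; apply.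
apply/eqP; rewrite -subr_eq0; apply/eqP; apply: (boundary_inj_B' qd).
  exact: subspaceB.
have sC := subspace_chains U pi e q.+1.
rewrite (lin_onB sC lbd); [|exact: B'C|exact: B'C].
rewrite txy lbd; [|exact: B'C|exact: B'C].
rewrite lbd; [|exact: B'C|exact: B'C].
rewrite tx ty (endo_trunc q).1 ?(endo_pB (ltnW qd)).1 ?subrr//; try exact: bdC.
  by apply: truncation_chains; exact: bdC.
by apply: truncation_chains; exact: bdC.
Qed.

Lemma endo_tilde_proj q : (q <= d)%N -> endo_on (Cq q) (fun w => tilde (pB' w)).
Proof.
case: q => [_|q qd]; first by apply: endo_on0; exact: subspace_chains.
have [l s] := endo_tilde qd; have [lp _] := endo_pB' qd.
split=> [a x y Cx Cy|x Cx].
  by rewrite lp// l//; [case: (proj_in qd Cx)|case: (proj_in qd Cy)].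
by apply: (B'_chains qd); apply: s; case: (proj_in qd Cx).
Qed.

(** The boundary maps the range injectively into the image of p_B Q one degree lower, which is
    finite-dimensional. *)
Lemma findim_tilde q : (q <= d)%N -> findim ((fun w => tilde (pB' w)) @` Cq q).
Proof.
case: q => [_|q qd].
  by exists 0%N, (fun=> 0) => _ [w _ <-]; apply: subspace0; exact: subspace_span.
have sC := subspace_chains U pi e q.+1.
have hT := endo_tilde_proj qd.
have sT := subspace_range sC hT.
have lbd := @boundary_lin _ _ _ _ U _ pi e q.
have TC := range_sub hT.
apply: (@findim_inj _ _ _ _ bd sT).
- by move=> a x y /TC Cx /TC Cy; exact: lbd.
- move=> _ [w Cw <-]; apply: (boundary_inj_B' qd).
  by apply: (endo_tilde qd).2; case: (proj_in qd Cw).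
- have hp := endo_pB (ltnW qd).
  apply: (@findimS _ _ _ (pB @` (trunc @` Cq q))).
    move=> _ [_ [w Cw <-] <-]; have [_ _ Bw _] := proj_in qd Cw.
    exists (trunc (bd (pB' w))); last by case: (tildeP qd Bw).
    exists (bd (pB' w)) => //; apply: (boundaries_chains (ltnW qd)).
    by exists (pB' w) => //; exact: (B'_chains qd).
  have ht := endo_trunc q; have sC' := subspace_chains U pi e q.
  apply: findim_image; first exact: subspace_range.
    by move=> a x y /(range_sub ht) Cx /(range_sub ht) Cy; exact: hp.1.
  exact: findim_truncation.
Qed.

(** The operator is a sum of five composites of a projection, the truncation and a projection, plus
    the tilde term, all of finite rank. *)
Lemma endo_Qbar q : (q <= d)%N -> endo_on (Cq q) (Qbar q) /\ findim ((Qbar q) @` Cq q).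
Proof.
move=> qd; have sC := subspace_chains U pi e q.
have hB := endo_pB qd; have hH := endo_pH qd; have hB' := endo_pB' qd.
have hQ := endo_trunc q; have ht := endo_tilde_proj qd.
have fQ : findim (trunc @` Cq q) by exact: findim_truncation.
have comp p p' : endo_on (Cq q) p -> endo_on (Cq q) p' ->
    endo_on (Cq q) (p \o trunc \o p') /\ findim ((p \o trunc \o p') @` Cq q).
  move=> hp hp'; split; last exact: findim_range_comp.
  by apply: endo_on_comp => //; exact: endo_on_comp.
have add p p' : endo_on (Cq q) p /\ findim (p @` Cq q) ->
    endo_on (Cq q) p' /\ findim (p' @` Cq q) ->
    endo_on (Cq q) (fun w => p w + p' w) /\ findim ((fun w => p w + p' w) @` Cq q).
  move=> [hp fp] [hp' fp']; split; first exact: endo_on_add.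
  exact: findim_range_add.
have bb := comp _ _ hB hB; have bh := comp _ _ hB hH; have hh := comp _ _ hH hH.
have bb' := comp _ _ hB hB'; have hb' := comp _ _ hH hB'.
exact: (add _ _ (add _ _ bb (add _ _ bh hh))
  (add _ _ (add _ _ bb' hb') (conj ht (findim_tilde qd)))).
Qed.

Lemma endo_TfQbar q : (q <= d)%N -> endo_on (Cq q) (fun w => Tf (Qbar q w)) /\
  findim ((fun w => Tf (Qbar q w)) @` Cq q).
Proof.
move=> qd; have [hQ fQ] := endo_Qbar qd; have hT := endo_Tf q.
split; first exact: endo_on_comp.
have := findim_range_comp (subspace_chains U pi e q) hT hQ (T2 := id) _ fQ.
by apply; split.
Qed.

(** It occurs in two roles: as the restriction of T_f Qbar_q to B_q, and as the operator that T_f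
    Qbar_(q+1) induces on B_q through the boundary. The projection is there because truncating a
    boundary need not give a boundary. *)
Definition boundary_op q (w : chain_map X V q) : chain_map X V q :=
  Tf (pB (trunc w)).

Lemma boundary_Tf q w : Cq q.+1 w -> bd (Tf w) = Tf (bd w).
Proof.
move=> Cw.
rewrite (conv_equivariant Gcont (smooth_chains U pi e q.+1) hmu hf
  (@boundary_lin _ _ _ _ U _ pi e q) Cw (act' := @translate R G d X V pi q)) //.
by move=> g; exact: (boundary_translate (U := U) (e := e)).
Qed.

Lemma Tf_boundaries q w : Bq q w -> Bq q (Tf w).
Proof.
move=> [v Cv <-]; exists (Tf v); first exact: (endo_Tf q.+1).2.
exact: boundary_Tf.
Qed.

Lemma endo_boundary_op q : (q <= d)%N -> endo_on (Bq q) (@boundary_op q).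
Proof.
move=> qd; have BC := boundaries_chains qd.
have hT := endo_on_comp (endo_Tf q) (endo_on_comp (endo_pB qd) (endo_trunc q)).
split=> [a x y /BC Cx /BC Cy|w /BC Cw]; first exact: hT.1.
by apply: Tf_boundaries; case: (proj_in qd (truncation_chains o r Cw)).
Qed.

Lemma TfQbar_boundaries q w : (q <= d)%N -> Bq q w ->
  Tf (Qbar q w) = boundary_op w.
Proof.
move=> qd Bw; have [eB eH eB'] := proj_boundaries qd Bw.
have sC := subspace_chains U pi e q.
have t0 : trunc (0 : chain_map X V q) = 0 by exact: (lin_on0 sC (endo_trunc q).1).
have pB0 : pB (0 : chain_map X V q) = 0 by exact: (lin_on0 sC (endo_pB qd).1).
have pH0 : pH (0 : chain_map X V q) = 0 by exact: (lin_on0 sC (endo_pH qd).1).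
have pB'0 : pB' (0 : chain_map X V q) = 0 by exact: (lin_on0 sC (endo_pB' qd).1).
have ti0 : tilde (0 : chain_map X V q) = 0.
  by have := lin_on0 sC (endo_tilde_proj qd).1; rewrite /= pB'0.
by rewrite /modified_truncation eB eH eB' t0 pB0 pH0 ti0 !addr0.
Qed.

(** The terms ending in p_B or p_H' are cycles, so only the tilde term survives the boundary, and it
    was defined to give p_B Q applied to the boundary of its argument. That boundary is the one of
    [w], since the other two components of [w] are cycles. *)
Lemma boundary_Qbar q w : (q < d)%N -> Cq q.+1 w ->
  bd (Qbar q.+1 w) = pB (trunc (bd w)).
Proof.
move=> qd Cw; have [BpB HpH BpB' ew] := proj_in qd Cw.
have lbd := @boundary_lin _ _ _ _ U _ pi e q.
have hp := endo_pB qd; have hh := endo_pH qd; have hq := endo_trunc q.+1.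
have BC := boundaries_chains qd.
have sC := subspace_chains U pi e q.+1.
have Z w' : Zq q.+1 w' -> Cq q.+1 w' /\ bd w' = 0 by [].
have pB_Z w' : Cq q.+1 w' -> Zq q.+1 (pB (trunc w')).
  move=> Cw'; apply: (boundaries_cycles qd).
  by case: (proj_in qd (truncation_chains o r Cw')).
have pH_Z w' : Cq q.+1 w' -> Zq q.+1 (pH (trunc w')).
  move=> Cw'; have [_ HZ _ _] := decomposition_complement qd; apply: HZ.
  by case: (proj_in qd (truncation_chains o r Cw')).
have CpB := BC _ BpB; have CpH := H'_chains qd HpH; have CpB' := B'_chains qd BpB'.
have sZ := subspace_cycles q.+1.
have -> : Qbar q.+1 w = (pB (trunc (pB w)) + (pB (trunc (pH w)) + pH (trunc (pH w)))
    + (pB (trunc (pB' w)) + pH (trunc (pB' w)))) + tilde (pB' w).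
  by rewrite /modified_truncation !addrA.
have [Bt et] := tildeP qd BpB'.
have [] := Z (pB (trunc (pB w)) + (pB (trunc (pH w)) + pH (trunc (pH w)))
    + (pB (trunc (pB' w)) + pH (trunc (pB' w)))).
  by do 4?[apply: (subspaceD sZ)]; auto.
move=> Cz bz; rewrite (lin_onD lbd Cz (B'_chains qd Bt)) bz add0r et.
congr (pB (trunc _)); rewrite [in RHS]ew (lin_onD lbd (subspaceD sC CpB CpH) CpB').
rewrite (lin_onD lbd CpB CpH).
have [_ ->] := Z _ (boundaries_cycles qd BpB).
have [_ HZ _ _] := decomposition_complement qd.
by have [_ ->] := Z _ (HZ _ HpH); rewrite !add0r.
Qed.

Lemma trace_step q : (q < d)%N -> exists t1 t2,
  [/\ is_trace (Bq q.+1) (@boundary_op q.+1) t1, is_trace (Bq q) (@boundary_op q) t2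
    & is_trace (Cq q.+1) (fun w => Tf (Qbar q.+1 w)) (t1 + t2)].
Proof.
move=> qd; have [hT fT] := endo_TfQbar qd.
have [|t1 [t2 [h1 h2 h3]]] := is_trace_exact (subspace_chains U pi e q.+1)
  (@boundary_lin _ _ _ _ U _ pi e q) (erefl _) hT.1 hT.2 (T2 := @boundary_op q) _ fT.
  move=> w Cw; rewrite boundary_Tf; first by rewrite boundary_Qbar.
  exact: (endo_Qbar qd).1.2.
exists t1, t2; split => //.
have eqZB : [set w | Cq q.+1 w /\ bd w = 0] = Bq q.+1.
  by case: hex => _ _ /(_ q.+1 qd).
rewrite eqZB in h1; apply: eq_is_trace h1 => w Bw.
exact: TfQbar_boundaries.
Qed.

(** No facet has a chart of dimension d + 1, so chains in degree d + 1 vanish. *)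
Lemma boundaries_top : Bq d = [set 0].
Proof.
have sC := subspace_chains U pi e d.+1.
apply/seteqP; split; last by move=> _ ->; exact: subspace0 (subspace_boundaries d).
move=> _ [w Cw <-] /=; suff -> : w = 0 by exact: (lin_on0 sC (@boundary_lin _ _ _ _ U _ pi e d)).
apply/funext => Fc; case: Cw => w1 _ _ _; apply: w1 => -[hF [P [chi [hchi _]]]].
by have := complex_dim_le (bt_complex X) hF hchi; rewrite ltnn.
Qed.

Lemma trace_top : is_trace (Bq d) (@boundary_op d) 0.
Proof.
rewrite boundaries_top; exists 0%N, (fun=> 0), 0; split.
- by case.
- by move=> c _ [].
- move=> w ->; exists (fun=> 0); rewrite big_ord0.
  exact: lin_on0 (subspace_boundaries d) (endo_boundary_op (leqnn d)).1.
- by case.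
- by rewrite mxtrace0.
Qed.

End ModifiedTruncation.

(** * The trace formula *)

Section TraceFormula.
Variables (R : realType) (G : ptopGroupType) (d : nat) (X : building R G d).
Variable U : schneider_stuhler_groups X.
Variables (V : lmodType R[i]) (pi : representation G V) (e : nat).
Variable mu : {measure set (borel G) -> \bar R}.
Variable f : G -> R[i].
Variables H' B' : forall q, set (chain_map X V q).
Hypothesis Gcont : translation_continuous G.
Hypothesis hadm : is_admissible pi.
Hypothesis hex : is_exact U pi e.
Hypothesis hmu : is_haar mu.
Hypothesis hf : is_test_function f.
Hypothesis hdec : is_decomposition U pi e H' B'.
Variable o : X.

Local Notation Cq q := (chains U pi e q).
Local Notation Bq q := (boundaries U pi e q).
Local Notation aug := (@augmentation R G d X V).
Local Notation pif := (rep_of_fun pi mu f).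
Local Notation pH := (@proj_H' R G d X U V pi e H' B' _).

Lemma smooth_rep : smooth_action [set: V] (fun g v => pi g v).
Proof.
split=> //.
- by move=> g a x y _ _; rewrite linearP.
- by move=> g h x _; exact: repM.
- move=> x _; apply: open_nbhs_nbhs; split; last exact: rep1.
  by case: hadm => + _; apply.
Qed.

Lemma augmentation_Tf w : Cq 0 w -> aug (chain_op pi mu f w) = pif (aug w).
Proof.
move=> Cw; rewrite (conv_equivariant Gcont (smooth_chains U pi e 0) hmu hf
  (@augmentation_lin _ _ _ _ U _ pi e) Cw (act' := fun g v => pi g v)) //.
by move=> g; exact: (augmentation_translate (U := U) (e := e)).
Qed.

Lemma augmentation_boundaries w : Bq 0 w -> aug w = 0.
Proof. by case: hex => _ <- _ []. Qed.

(** In degree 0 every chain counts as a cycle, so the complement of the cycles is zero. *)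
Lemma B'0_eq0 b : @B' 0 b -> b = 0.
Proof.
move=> Bb; have cB := decomposition_complement' hdec (leq0n d).
apply: (complement_inj cB) => //.
exact: (B'_chains hdec (leq0n d)).
Qed.

Lemma H'0_inj h h' : @H' 0 h -> @H' 0 h' -> aug h = aug h' -> h = h'.
Proof.
move=> Hh Hh' ehh'; apply/eqP; rewrite -subr_eq0; apply/eqP.
have Ch := H'_chains hdec (leq0n d) Hh; have Ch' := H'_chains hdec (leq0n d) Hh'.
have sC := subspace_chains U pi e 0.
apply: (complement_inj (decomposition_complement hdec (leq0n d))).
  by apply: subspaceB => //; exact: (subspace_H' hdec (leq0n d)).
have eqB : [set w | Cq 0 w /\ aug w = 0] = Bq 0 by case: hex.
suff : [set w | Cq 0 w /\ aug w = 0] (h - h') by rewrite eqB.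
split; first exact: subspaceB.
by rewrite (lin_onB sC (@augmentation_lin _ _ _ _ U _ pi e))// ehh' subrr.
Qed.

Lemma aug_proj_H' w : Cq 0 w -> aug (pH w) = aug w.
Proof.
move=> Cw; have [BpB HpH /B'0_eq0 e0 {2}->] := proj_in hex hdec (leq0n d) Cw.
rewrite e0 addr0 (lin_onD (@augmentation_lin _ _ _ _ U _ pi e)).
- by rewrite (augmentation_boundaries BpB) add0r.
- exact: (boundaries_chains hex (leq0n d)).
- exact: (H'_chains hdec (leq0n d)).
Qed.

Lemma H'0_lift v : exists2 h, @H' 0 h & aug h = v.
Proof.
case: hex => surj _ _; have : [set: V] v by [].
rewrite -surj => -[w Cw <-]; exists (pH w); last exact: aug_proj_H'.
by case: (proj_in hex hdec (leq0n d) Cw).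
Qed.

(** In degree 0 the augmentation takes the place of the boundary. It kills B_0 and B'_(-1) vanishes,
    so of Qbar_0 [w] it sees only p_H' Q_0 p_H' [w], with p_H' [w] equal to [s (aug w)]. The choice
    [s] is not assumed linear; [T2] is linear because it is induced by T_f Qbar_0. *)
Lemma trace_step0 r (s : V -> chain_map X V 0) : 0 <= r ->
  (forall v, @H' 0 (s v) /\ aug (s v) = v) ->
  let T2 v := pif (aug (truncation o r (s v))) in
  lin_on setT T2 /\ exists t1 t2,
  [/\ is_trace (Bq 0) (@boundary_op R G d X U V pi e mu f H' B' o r 0) t1,
      is_trace setT T2 t2
    & is_trace (Cq 0) (fun w => chain_op pi mu f
        (modified_truncation U pi e H' B' o r 0 w)) (t1 + t2)].
Proof.
move=> r0 hs T2; have sC := subspace_chains U pi e 0.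
have [hT fT] := endo_TfQbar Gcont hadm hex hmu hf hdec o r0 (leq0n d).
have laug := @augmentation_lin _ _ _ _ U _ pi e.
have inter w : Cq 0 w -> aug (chain_op pi mu f
    (modified_truncation U pi e H' B' o r 0 w)) = T2 (aug w).
  move=> Cw; have CQ := (endo_Qbar hadm hex hdec o r0 (leq0n d)).1.2 w Cw.
  rewrite augmentation_Tf//; congr (pif _).
  have [BpB HpH /B'0_eq0 e0 ew] := proj_in hex hdec (leq0n d) Cw.
  rewrite -aug_proj_H'//.
  have -> : s (aug w) = pH w.
    apply: H'0_inj => //; first by case: (hs (aug w)).
    by rewrite aug_proj_H'//; case: (hs (aug w)).
  have CpH := H'_chains hdec (leq0n d) HpH.
  have CpB := boundaries_chains hex (leq0n d) BpB.
  have PP w' : Cq 0 w' -> Bq 0 (proj_B U pi e H' B' (truncation o r w'))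
      /\ @H' 0 (pH (truncation o r w')).
    by move=> Cw'; case: (proj_in hex hdec (leq0n d) (truncation_chains o r Cw')).
  rewrite -[RHS]aug_proj_H'; last exact: truncation_chains.
  congr aug; rewrite /modified_truncation e0.
  have C0 : Cq 0 (0 : chain_map X V 0) by exact: subspace0.
  have t0 : truncation o r (0 : chain_map X V 0) = 0.
    exact: (lin_on0 sC (endo_trunc U pi e o r 0).1).
  have pB0 : proj_B U pi e H' B' (0 : chain_map X V 0) = 0.
    exact: (lin_on0 sC (endo_pB hex hdec (leq0n d)).1).
  have pH0 : pH (0 : chain_map X V 0) = 0.
    exact: (lin_on0 sC (endo_pH hex hdec (leq0n d)).1).
  rewrite t0 pB0 pH0 !addr0 addrA.
  have [_ eqH _] := projE hex hdec (leq0n d)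
    (subspaceD (subspace_boundaries U pi e 0) (PP _ CpB).1 (PP _ CpH).1)
    (PP _ CpH).2 (subspace0 (subspace_B' hdec (leq0n d))).
  by rewrite addr0 in eqH.
have surj : aug @` Cq 0 = setT by case: hex.
split.
  by rewrite -surj; exact: (lin_on_quotient sC laug hT).
have [t1 [t2 [h1 h2 h3]]] := is_trace_exact sC laug surj hT.1 hT.2 inter fT.
exists t1, t2; split => //.
have eqB : [set w | Cq 0 w /\ aug w = 0] = Bq 0 by case: hex.
rewrite eqB in h1; apply: eq_is_trace h1 => w Bw.
exact: (TfQbar_boundaries mu f hex hdec o r (leq0n d) Bw).
Qed.

(** The groups attached to any single facet shrink to 1; a facet exists because the complex has
    dimension d. *)
Lemma small_subgroups N : nbhs (1%g : G) N ->
  exists H : set G, [/\ is_subgroup H, open H, compact H & H `<=` N].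
Proof.
have [A [P [chi [hA _]]]] := complex_dim (bt_complex X).
move=> /(ss_fundamental U hA)[n hn]; exists (U A n); split => //.
- exact: ss_subgroup.
- exact: ss_open.
- exact: ss_compact.
Qed.

Lemma findim_rep_of_fun : exists2 W : set V, is_subspace W /\ findim W &
  forall v, W (pif v).
Proof.
have [|N hN fN] := test_function_left_invariant Gcont hf.
  by move=> N /small_subgroups[H [sH oH _ HN]]; exists H.
have [H [sH oH cH HN]] := small_subgroups hN.
exists (fixed_vectors pi H).
  split; last by case: hadm => _ /(_ H sH oH cH)[n [b hb]]; exists n, b.
  split; first by move=> g _; rewrite linear0.
  by move=> a x y fx fy g Hg; rewrite linearP fx// fy.
move=> v g Hg; apply: (conv_fixed Gcont smooth_rep hmu hf) => // x.
by apply: fN; exact: HN.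
Qed.

Theorem trace_formula : exists r0 : R, 0 <= r0 /\ forall r : R, r0 <= r ->
    \sum_(q < d.+1) (-1) ^+ q *
      trace (Cq q)
        (fun w => chain_op pi mu f (modified_truncation U pi e H' B' o r q w))
    = trace [set: V] pif.
Proof.
have /choice[s hs] v : exists h, @H' 0 h /\ aug h = v.
  by have [h Hh eh] := H'0_lift v; exists h.
have lpif : lin_on setT pif := conv_lin Gcont smooth_rep hmu hf.
have sT : is_subspace [set: V] by [].
have [W [sW fW] WP] := findim_rep_of_fun.
have [n [b [Wb indb spb]]] := findim_basis sW fW.
have Cs v : Cq 0 (s v) by apply: (H'_chains hdec (leq0n d)); case: (hs v).
have /choice[rb hrb] i : exists r0, 0 <= r0 /\
    forall r, r0 <= r -> truncation o r (s (b i)) = s (b i).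
  by have [r0 r0ge0 h] := truncation_id o (Cs (b i)); exists r0.
(* The radii [rb i] are nonnegative, so their sum dominates each of them, and every lift [s (b i)]
   is fixed by the truncation. *)
exists (\sum_i rb i); split; first by apply: sumr_ge0 => i _; case: (hrb i).
move=> r rge.
have r0 : 0 <= r by apply: le_trans rge; apply: sumr_ge0 => i _; case: (hrb i).
have trb i : truncation o r (s (b i)) = s (b i).
  case: (hrb i) => _; apply; apply: le_trans rge; rewrite (bigD1 i)//= lerDl.
  by apply: sumr_ge0 => j _; case: (hrb j).
have [lT2 [t0 [tau [ht0 htau hC0]]]] := trace_step0 r0 hs.
set T2 := fun v => _ in lT2 htau.
have /choice[a ha] i : exists c : 'I_n -> R[i], pif (b i) = \sum_j c j *: b j.
  exact: spb.
pose A := \matrix_(i, j) a i j.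
have haA i : pif (b i) = \sum_j A i j *: b j.
  by rewrite ha; apply: eq_bigr => j _; rewrite mxE.
have tr_pif : is_trace [set: V] pif (\tr A).
  by exists n, b, A; split => // v _; exact: spb.
(* [T2] and pi(f) may differ on [V], but both take values in the span of [b] and they agree on each
   [b i], so one matrix computes both traces. *)
have tr_T2 : is_trace [set: V] T2 (\tr A).
  exists n, b, A; split => // [v _|i]; first by apply: spb; exact: WP.
  by rewrite /T2 trb; case: (hs (b i)) => _ ->.
rewrite (traceE sT lpif tr_pif) -(is_trace_uniq sT lT2 htau tr_T2).
pose Bop q := @boundary_op R G d X U V pi e mu f H' B' o r q.
pose beta q := trace (Bq q) (Bop q).
have sB q := subspace_boundaries U pi e q.
have lB q : (q <= d)%N -> lin_on (Bq q) (Bop q).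
  by move=> qd; exact: (endo_boundary_op Gcont hex hmu hf hdec o r qd).1.
pose TQ q w := chain_op pi mu f (modified_truncation U pi e H' B' o r q w).
have lTQ q : (q <= d)%N -> lin_on (Cq q) (TQ q).
  by move=> qd; exact: (endo_TfQbar Gcont hadm hex hmu hf hdec o r0 qd).1.1.
have sC q := subspace_chains U pi e q.
have tr0 : trace (Cq 0) (TQ 0%N) = beta 0%N + tau.
  rewrite (traceE (sC 0%N) (lTQ 0%N (leq0n d)) hC0).
  by rewrite /beta (traceE (sB 0%N) (lB 0%N (leq0n d)) ht0).
have trS q : (q < d)%N -> trace (Cq q.+1) (TQ q.+1) = beta q.+1 + beta q.
  move=> qd; have [t1 [t2 [h1 h2 h3]]] := trace_step Gcont hadm hex hmu hf hdec o r0 qd.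
  rewrite (traceE (sC q.+1) (lTQ q.+1 qd) h3) /beta.
  by rewrite (traceE (sB q.+1) (lB q.+1 qd) h1) (traceE (sB q) (lB q (ltnW qd)) h2).
have betad : beta d = 0.
  exact: (traceE (sB d) (lB d (leqnn d)) (trace_top Gcont hex hmu hf hdec o r)).
(* The traces telescope, leaving the boundary term with [beta m], which vanishes at m = d. *)
have partial m : (m <= d)%N ->
    \sum_(q < m.+1) (-1) ^+ q * trace (Cq q) (TQ q) = tau + (-1) ^+ m * beta m.
  elim: m => [_|m IH md].
    by rewrite big_ord_recl big_ord0 /= tr0 expr0 !mul1r addr0 addrC.
  by rewrite big_ord_recr /= IH 1?ltnW// trS// exprS; ring.
by have := partial d (leqnn d); rewrite betad mulr0 addr0.
Qed.

End TraceFormula.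

Theorem theorem23 (R : realType)
  (* k is a finite extension of Q_p and K an algebraic closure of k *)
  (p : nat) (Qp : fieldType) (absp : Qp -> R) (hQp : is_Qp p absp)
  (k : fieldExtType Qp)
  (K : closedFieldType) (iota : {rmorphism k -> K}) (hK : integralRange iota)
  (* connected reductive group over k, of semisimple k-rank d *)
  (n : nat) (GG : algebraicGroup iota n)
  (hconn : zariski_connected (geom_points GG)) (hred : is_reductive GG)
  (d : nat) (hd : is_semisimple_rank GG d)
  (mu : {measure set (borel (kpoints absp GG)) -> \bar R}) (hmu : is_haar mu)
  (X : building R (kpoints absp GG) d) (U : schneider_stuhler_groups X)
  (V : lmodType R[i]) (pi : representation (kpoints absp GG) V)
  (hfg : is_finitely_generated pi) (hadm : is_admissible pi)
  (e0 : nat) (he0 : forall e : nat, (e0 <= e)%N -> is_exact U pi e)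
  (e : nat) (he : (e0 <= e)%N)
  (f : kpoints absp GG -> R[i]) (hf : is_test_function f)
  (o : X)
  (H' B' : forall q : nat, set (chain_map X V q))
  (hdec : is_decomposition U pi e H' B') :
  exists r0 : R, 0 <= r0 /\ forall r : R, r0 <= r ->
    \sum_(q < d.+1) (-1) ^+ q *
      trace (chains U pi e q)
        (fun w => chain_op pi mu f (modified_truncation U pi e H' B' o r q w))
    = trace [set: V] (rep_of_fun pi mu f).
Proof.
exact: (trace_formula (@kpoints_translation_continuous _ _ _ _ hQp _ _ _ _ GG) hadm (he0 _ he) hmu hf hdec o).
Qed.
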